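(* Let $n$ be a positive integer, $\mathbf a\in\{0,1\}^n$, and $\lambda=\lambda(\mathbf a)=(a_1+\cdots+a_n,\ldots,a_1+a_2,a_1)$. Regarding $|\lambda|!\cdot v^{(n,m)}(\mathbf a,\mathbf 0)$ as a polynomial in $m$, its leading term (the coefficient of $m^{|\lambda|}$) is $p_{\mathbf a,\mathbf 0,|\lambda|}$, and $p_{\mathbf a,\mathbf 0,|\lambda|}$ equals the number of standard Young tableaux of the shifted skew shape $\nu/\rho$.
   Context: $v^{(n,m)}(\mathbf a,\mathbf 0)$ is the number of vertices of the flow polytope $\mathcal F_{G(n,m)}(\mathbf a)$, where $G(n,m)$ has vertices $\{(i,j):1\le i\le n,0\le j\le m\}\cup\{s\}$ and edges $((i,j),(i,j+1))$ ($1\le i\le n$, $0\le j\le m-1$), $((i,j),(i+1,j))$ ($1\le i\le n-1$, $0\le j\le m$), $((n,j),s)$ ($0\le j\le m$), and the polytope consists of nonnegative edge weightings with outflow minus inflow equal to $a_i$ at $(i,0)$, $-\sum a_i$ at $s$, $0$ elsewhere. It is a polynomial in $m$. $p_{\mathbf a,\mathbf 0,k}$ is the number of vertex plane partitions of shape $\lambda$ with entries at most $k-1$ in which every value $0,\dots,k-1$ occurs; so $p_{\mathbf a,\mathbf 0,|\lambda|}$ counts vertex plane partitions of shape $\lambda$ with distinct entries $0,\dots,|\lambda|-1$. A plane partition of shape $\lambda$ is a filling by nonnegative integers weakly decreasing along rows and down columns. With $\lambda'_j=\#\{i:\lambda_i\ge j\}$ and $\pi_{i,j}$ the entry in row $i$,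 column $j$ (column $j$ = rows $1\le i\le\lambda'_j$; here $\mu=0$ so $\mu'_j=0$), $\pi$ is a vertex plane partition if for all adjacent columns $j,j+1$: (i) if $\lambda'_j=\lambda'_{j+1}$: $\pi_{i,j}=\pi_{i,j+1}$ for all $i$; (ii) if $\lambda'_j>\lambda'_{j+1}$: $\pi_{i,j}=\pi_{i,j+1}$ for some $2\le i\le\lambda'_{j+1}$ implies $\pi_{i-1,j}=\pi_{i-1,j+1}$; and for every $1\le i\le\lambda'_{j+1}$, $\pi_{i,j+1}<\pi_{i+1,j}$ or $\pi_{i,j+1}=\pi_{i,j}$. The shifted skew shape $\nu/\rho$ is the shifted skew shape with the same column lengths, read from right to left, as $\lambda$: concretely, with the shifted staircase $\{(r,k):1\le r\le k\le n\}$ (row $r$, column $k$), $\nu/\rho$ is the set of cells $(r,k)$ with $k-\lambda'_{n+1-k}<r\le k$ (with $\lambda'_c=0$ for $c>\lambda_1$). A standard Young tableau of shape $\nu/\rho$ is a bijective filling of its cells with $1,\dots,|\lambda|$ increasing along rows and down columns. *)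

(* Defs.v *)
From HB Require Import structures.
From mathcomp Require Import all_boot all_order all_algebra.
Set Implicit Arguments. Unset Strict Implicit. Unset Printing Implicit Defensive.
Import Order.TTheory GRing.Theory Num.Theory.

Definition acoef (n : nat) (a : n.-tuple bool) (j : nat) : nat :=
  nth false a j.-1.

(* lambda(a) = (a_1+...+a_n, ..., a_1+a_2, a_1), 1-indexed:
   lambda_i = a_1 + ... + a_{n+1-i}, for 1 <= i <= n (0 for i > n). *)
Definition lam (n : nat) (a : n.-tuple bool) (i : nat) : nat :=
  \sum_(1 <= j < (n.+1 - i).+1) acoef a j.

Definition lsize (n : nat) (a : n.-tuple bool) : nat :=
  \sum_(1 <= i < n.+1) lam a i.

Definition lamc (n : nat) (a : n.-tuple bool) (j : nat) : nat :=
  count (fun i => j <= lam a i) (iota 1 n).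

Definition in_lam (n : nat) (a : n.-tuple bool) (i j : nat) : bool :=
  [&& 1 <= i, i <= n, 1 <= j & j <= lam a i].

(* Fillings of shapes contained in the n x n grid.  A filling with     *)
(* values in 'I_k is encoded by f : {ffun 'I_n * 'I_n -> option 'I_k}, *)
(* with f (i',j') = Some v exactly on cells of the shape (0-indexed    *)
(* ordinals i' = i-1, j' = j-1).                                       *)
Definition grid_get (n k : nat) (f : {ffun 'I_n * 'I_n -> option 'I_k})
    (i j : nat) : option 'I_k :=
  match @insub _ (fun x => x < n) 'I_n i.-1, @insub _ (fun x => x < n) 'I_n j.-1 with
  | Some i', Some j' => if (0 < i) && (0 < j) then f (i', j') else None
  | _, _ => None
  end.

Definition ent (n k : nat) (f : {ffun 'I_n * 'I_n -> option 'I_k}) (i j : nat)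
  : nat := odflt 0 (omap val (grid_get f i j)).

Definition vpp_shape (n k : nat) (a : n.-tuple bool)
    (f : {ffun 'I_n * 'I_n -> option 'I_k}) : bool :=
  [forall c : 'I_n * 'I_n,
     (f c != None) == in_lam a (c.1 : nat).+1 (c.2 : nat).+1].

Definition plane_partition (n k : nat) (a : n.-tuple bool)
    (f : {ffun 'I_n * 'I_n -> option 'I_k}) : bool :=
  all (fun i => all (fun j =>
     (in_lam a i j.+1 ==> (ent f i j.+1 <= ent f i j)) &&
     (in_lam a i.+1 j ==> (ent f i.+1 j <= ent f i j))) (iota 1 n)) (iota 1 n).

(* the vertex conditions (i), (ii) for adjacent columns j, j+1
   (for j >= n both conditions are vacuous since lambda_1 <= n) *)
Definition vertex_cond (n k : nat) (a : n.-tuple bool)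
    (f : {ffun 'I_n * 'I_n -> option 'I_k}) : bool :=
  all (fun j =>
    (if lamc a j == lamc a j.+1 then
       all (fun i => ent f i j == ent f i j.+1) (iota 1 (lamc a j))
     else if lamc a j.+1 < lamc a j then
       all (fun i => (ent f i j == ent f i j.+1) ==>
                      (ent f i.-1 j == ent f i.-1 j.+1))
           (iota 2 (lamc a j.+1).-1)
       && all (fun i => (ent f i j.+1 < ent f i.+1 j) ||
                        (ent f i j.+1 == ent f i j))
           (iota 1 (lamc a j.+1))
     else true)) (iota 1 n).

Definition all_values_occur (n k : nat)
    (f : {ffun 'I_n * 'I_n -> option 'I_k}) : bool :=
  [forall v : 'I_k, [exists c, f c == Some v]].

Definition is_vpp (n k : nat) (a : n.-tuple bool)
    (f : {ffun 'I_n * 'I_n -> option 'I_k}) : bool :=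
  [&& vpp_shape a f, plane_partition a f, vertex_cond a f
    & all_values_occur f].

Definition p_a0 (n : nat) (a : n.-tuple bool) (k : nat) : nat :=
  #|[set f : {ffun 'I_n * 'I_n -> option 'I_k} | is_vpp a f]|.

Definition in_shifted (n : nat) (a : n.-tuple bool) (r k : nat) : bool :=
  [&& 1 <= r, r <= k, k <= n & k - lamc a (n.+1 - k) < r].

(* standard Young tableaux: entries 1..N (entry = value + 1),
   bijective, strictly increasing along rows and down columns *)
Definition is_syt (n N : nat) (a : n.-tuple bool)
    (T : {ffun 'I_n * 'I_n -> option 'I_N}) : bool :=
  [&& [forall c : 'I_n * 'I_n,
         (T c != None) == in_shifted a (c.1 : nat).+1 (c.2 : nat).+1],
      [forall v : 'I_N, [exists c, T c == Some v]],
      [forall c : 'I_n * 'I_n, forall d : 'I_n * 'I_n,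
         (T c != None) ==> (T c == T d) ==> (c == d)],
      all (fun r => all (fun k => all (fun k' =>
          (in_shifted a r k && in_shifted a r k' && (k < k'))
            ==> (ent T r k < ent T r k')) (iota 1 n)) (iota 1 n)) (iota 1 n)
    & all (fun k => all (fun r => all (fun r' =>
          (in_shifted a r k && in_shifted a r' k && (r < r'))
            ==> (ent T r k < ent T r' k)) (iota 1 n)) (iota 1 n)) (iota 1 n)].

Definition syt_count (n : nat) (a : n.-tuple bool) : nat :=
  #|[set T : {ffun 'I_n * 'I_n -> option 'I_(lsize a)} | is_syt a T]|.

(* Vertex Some (i',j') stands for (i'+1, j') (1 <= i <= n, 0<=j<=m);   *)
(* None stands for the sink s.                                          *)
Local Open Scope ring_scope.

Definition gvert (n m : nat) := option ('I_n * 'I_m.+1).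

Definition is_gedge (n m : nat) (e : gvert n m * gvert n m) : bool :=
  match e with
  | (Some (i, j), Some (i', j')) =>
      ((i == i' :> nat) && (j.+1 == j' :> nat)%N) ||
      ((i.+1 == i' :> nat) && (j == j' :> nat))
  | (Some (i, j), None) => i.+1 == n
  | _ => false
  end.

Definition gedge (n m : nat) := {e : gvert n m * gvert n m | is_gedge e}.

Definition netflow (R : numDomainType) (n m : nat) (a : n.-tuple bool)
    (v : gvert n m) : R :=
  match v with
  | Some (i, j) => if (j : nat) == 0 then ((acoef a (i : nat).+1)%N)%:R else 0
  | None => - ((\sum_(1 <= i < n.+1) acoef a i)%N)%:R
  end.

Definition in_flow_polytope (R : numDomainType) (n m : nat) (a : n.-tuple bool)
    (x : {ffun gedge n m -> R}) : Prop :=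
  (forall e, 0 <= x e)%R /\
  forall v : gvert n m,
    (\sum_(e : gedge n m | (val e).1 == v) x e
       - \sum_(e : gedge n m | (val e).2 == v) x e)%R = netflow R a v.

Definition is_poly_vertex (R : numDomainType) (n m : nat) (a : n.-tuple bool)
    (x : {ffun gedge n m -> R}) : Prop :=
  in_flow_polytope a x /\
  forall (y z : {ffun gedge n m -> R}) (t : R),
    in_flow_polytope a y -> in_flow_polytope a z -> (0 < t < 1)%R ->
    (forall e, x e = t * y e + (1 - t) * z e)%R -> y = z.

Definition num_vertices_is (R : numDomainType) (n m : nat) (a : n.-tuple bool)
    (k : nat) : Prop :=
  exists s : seq {ffun gedge n m -> R},
    [/\ uniq s, size s = k &
        forall x, is_poly_vertex a x <-> x \in s].

(* Main.v *)
Require Import Defs.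
From HB Require Import structures.
From mathcomp Require Import all_boot all_order all_algebra zify ring lra.
Import Order.TTheory GRing.Theory Num.Theory.
Set Implicit Arguments. Unset Strict Implicit. Unset Printing Implicit Defensive.

(** Let g(i,j) be the total flow leaving row i downwards in columns >= j.  In
    these coordinates the flow polytope is a marked order polytope: g decreases
    in j, increases in i, and is prescribed on the boundary.  A point is a
    vertex iff each of its level sets is connected to the boundary, since a
    detached level set can be shifted up and down.  Vertices are therefore
    integral, and the conjugates of the rows of g form a plane partition of
    shape lambda, on which connectedness is the condition
    pi(i,j+1) < pi(i+1,j) or pi(i,j+1) = pi(i,j).  This condition only depends
    on the relative order of the entries, so with m+1 possible entries the
    number of vertices is the sum over k of p_k * binomial(m+1, k), and its
    leading term comes from k = |lambda|.  When all entries are distinct the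
    conditions say that pi decreases down the columns and from (i+1,j) to
    (i,j+1); reading columns from right to left and bottom to top, these are
    the relations of a standard tableau of the shifted shape. *)

(** A downward closed predicate holds on an initial segment of 1, ..., l, whose length is the count.
    This is the conjugation rule for partitions, applied to [lamc], to [levels] and to the inverse
    of [levels]. *)
Lemma count_iota_down (P : pred nat) (l i : nat) :
  (forall u v, 0 < u -> u <= v -> P v -> P u) -> 0 < i <= l ->
  (i <= count P (iota 1 l)) = P i.
Proof.
move=> Pdown /andP[i0 il].
have El : l = i.-1 + (1 + (l - i)) by lia.
rewrite El iotaD count_cat iotaD count_cat /= addn0.
have Ei : 1 + i.-1 = i by lia.
rewrite Ei; case: (boolP (P i)) => Pi.
  have -> : count P (iota 1 i.-1) = i.-1.
    rewrite -[RHS](size_iota 1); apply/eqP; rewrite -all_count.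
    by apply/allP=> u; rewrite mem_iota => ?; apply: Pdown Pi; lia.
  by lia.
have -> : count P (iota (i + 1) (l - i)) = 0.
  apply/eqP; rewrite -leqn0 leqNgt -has_count; apply/hasPn => u.
  by rewrite mem_iota => ?; apply: contra Pi; apply: Pdown; lia.
have := count_size P (iota 1 i.-1); rewrite size_iota.
by lia.
Qed.

Lemma all_iotaP (P : pred nat) (s l : nat) :
  reflect (forall i, s <= i < s + l -> P i) (all P (iota s l)).
Proof.
by apply: (iffP allP) => H i; have := H i; rewrite mem_iota.
Qed.

(** * The shape lambda and its vertex plane partitions *)

Section Shape.
Variables (n : nat) (a : n.-tuple bool).

Definition apref (i : nat) : nat := \sum_(1 <= j < i.+1) acoef a j.

Lemma lam_apref i : lam a i = apref (n.+1 - i).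
Proof. by []. Qed.

Lemma apref0 : apref 0 = 0.
Proof. by rewrite /apref big_geq. Qed.

Lemma aprefS i : apref i.+1 = apref i + acoef a i.+1.
Proof. by rewrite /apref big_nat_recr. Qed.

Lemma acoef_le1 i : acoef a i <= 1.
Proof. by rewrite /acoef leq_b1. Qed.

Lemma apref_le i : apref i <= i.
Proof.
elim: i => [|i IH]; first by rewrite apref0.
by rewrite aprefS; have := acoef_le1 i.+1; lia.
Qed.

Lemma leq_apref i i' : i <= i' -> apref i <= apref i'.
Proof.
move/subnKC <-; elim: (i' - i) => [|k IH]; first by rewrite addn0.
by rewrite addnS aprefS; lia.
Qed.

Lemma lam_le i : 0 < i -> lam a i <= n.
Proof. by move=> ?; rewrite lam_apref; have := apref_le (n.+1 - i); lia. Qed.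

Lemma lam_anti i i' : i <= i' -> lam a i' <= lam a i.
Proof. by move=> ?; rewrite !lam_apref; apply: leq_apref; lia. Qed.

Lemma lamS i : i <= n -> lam a i <= (lam a i.+1).+1.
Proof.
move=> ?; rewrite !lam_apref subSS subSn // aprefS.
by have := acoef_le1 (n - i).+1; lia.
Qed.

Lemma in_lam_bounds i j : in_lam a i j -> (0 < i <= n) && (0 < j <= n).
Proof.
case/and4P=> i0 iN j0 jl; rewrite i0 iN j0 /=.
by apply: leq_trans jl (lam_le i0).
Qed.

Lemma in_lam_sub i j i' j' : in_lam a i j ->
  0 < i' <= i -> 0 < j' <= j -> in_lam a i' j'.
Proof.
case/and4P=> i0 iN j0 jl /andP[i'0 i'i] /andP[j'0 j'j].
apply/and4P; split=> //; first exact: leq_trans i'i iN.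
by apply: leq_trans j'j (leq_trans jl _); apply: lam_anti.
Qed.

(* Consecutive rows of lambda differ by at most one cell, equivalently the
   nonempty columns have pairwise distinct lengths. *)
Lemma in_lam_antidiag i j : 0 < j -> in_lam a i j.+1 -> in_lam a i.+1 j.
Proof.
move=> j0 /and4P[i0 iN _ jl]; have := lamS iN.
apply: contraTT => Hn; rewrite -ltnNge.
case: (ltnP i n) => [iltn|]; first by move: Hn; rewrite /in_lam; lia.
move=> ni; have E: i = n by apply/eqP; rewrite eqn_leq iN.
by move: jl; rewrite E lam_apref subSn // subnn; have := apref_le 1; lia.
Qed.

Lemma leq_lamc i j : 0 < i <= n -> (i <= lamc a j) = (j <= lam a i).
Proof.
move=> Hi; rewrite /lamc (count_iota_down _ Hi) // => u v u0 uv jl.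
exact: leq_trans jl (lam_anti uv).
Qed.

Lemma lamc_le j : lamc a j <= n.
Proof. by rewrite -[X in _ <= X](size_iota 1) count_size. Qed.

Lemma in_lamE i j : 0 < j -> in_lam a i j = (0 < i <= lamc a j).
Proof.
move=> j0; rewrite /in_lam j0; case: (ltnP 0 i) => //= i0.
case: (leqP i n) => iN /=; first by rewrite leq_lamc // i0.
by apply/esym/negbTE; rewrite -ltnNge; apply: leq_ltn_trans iN; apply: lamc_le.
Qed.

(** By [in_lam_antidiag], below the level of the bottom cell of column j+1 there is still a cell in
    column j. So adjacent columns of equal length are empty, and condition (i) is vacuous. *)
Lemma lamc_decr j : 0 < j -> 0 < lamc a j.+1 -> lamc a j.+1 < lamc a j.
Proof.
move=> j0 l0; have : in_lam a (lamc a j.+1) j.+1 by rewrite in_lamE // l0 leqnn.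
by move/(in_lam_antidiag j0); rewrite in_lamE.
Qed.

(** What remains of the vertex conditions, for a bare function, so that it can be moved between
    fillings, tableaux and arrays. *)
Definition good (e : nat -> nat -> nat) : Prop :=
  [/\ forall i j, 0 < j -> in_lam a i j.+1 -> e i j.+1 <= e i j,
      forall i j, 0 < i -> in_lam a i.+1 j -> e i.+1 j <= e i j
    & forall i j, 0 < j -> in_lam a i j.+1 ->
        (e i j.+1 < e i.+1 j) || (e i j.+1 == e i j)].

(** Only entries inside the shape are compared, the cell (i+1,j) belonging to it by
    [in_lam_antidiag]. *)
Lemma good_relabel e e' :
  (forall i j i' j', in_lam a i j -> in_lam a i' j' ->
     (e' i j <= e' i' j') = (e i j <= e i' j')) ->
  good e -> good e'.
Proof.
move=> H [G1 G2 G3]; split=> i j h0 hc.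
- have hc' : in_lam a i j by apply: (in_lam_sub hc); have := in_lam_bounds hc; lia.
  by rewrite H //; apply: G1.
- have hc' : in_lam a i j by apply: (in_lam_sub hc); have := in_lam_bounds hc; lia.
  by rewrite H //; apply: G2.
have hc' : in_lam a i j by apply: (in_lam_sub hc); have := in_lam_bounds hc; lia.
have hd := in_lam_antidiag h0 hc.
by rewrite ltnNge eqn_leq !H // -ltnNge -eqn_leq; apply: G3.
Qed.

Section Filling.
Variable k : nat.
Implicit Types f : {ffun 'I_n * 'I_n -> option 'I_k}.

Definition vfill f := [&& vpp_shape a f, plane_partition a f & vertex_cond a f].

Lemma entE f (c : 'I_n * 'I_n) :
  ent f (c.1 : nat).+1 (c.2 : nat).+1 = odflt 0 (omap val (f c)).
Proof. by case: c => i j; rewrite /ent /grid_get /= !valK. Qed.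

Lemma in_lam_ord i j : in_lam a i j ->
  exists c : 'I_n * 'I_n, i = (c.1 : nat).+1 /\ j = (c.2 : nat).+1.
Proof.
move/in_lam_bounds => H.
have Hi : i.-1 < n by lia.
have Hj : j.-1 < n by lia.
by exists (Ordinal Hi, Ordinal Hj) => /=; lia.
Qed.

Lemma shapeP f : reflect (forall c : 'I_n * 'I_n,
    (f c != None) = in_lam a (c.1 : nat).+1 (c.2 : nat).+1) (vpp_shape a f).
Proof. by apply: (iffP forallP) => H c; [apply: (eqP (H c))|rewrite H]. Qed.

Lemma ent_lt f i j : 0 < k -> ent f i j < k.
Proof. by move=> k0; rewrite /ent; case: grid_get => //= v; apply: ltn_ord. Qed.

(** Condition (i) is vacuous by [lamc_decr]. The first clause of (ii) follows from the second: if
    row i has a tie and row i-1 has none, then e(i-1,j+1) < e(i,j) = e(i,j+1), against the decrease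
    down column j+1. *)
Lemma vertex_condP f : plane_partition a f ->
  reflect (forall i j, 0 < j -> in_lam a i j.+1 ->
        (ent f i j.+1 < ent f i.+1 j) || (ent f i j.+1 == ent f i j))
   (vertex_cond a f).
Proof.
move=> pp; apply: (iffP (all_iotaP _ _ _)) => [H i j j0 hc|H j hj].
  have hb := in_lam_bounds hc.
  have := H j ltac:(lia); rewrite in_lamE // in hc.
  have lt := @lamc_decr j j0 (leq_trans (proj1 (andP hc)) (proj2 (andP hc))).
  rewrite gtn_eqF // lt => /andP[_ /all_iotaP H2].
  by apply: H2; lia.
have j0 : 0 < j by lia.
case: ifP => [/eqP E|_].
  apply/all_iotaP => i hi; have := @lamc_decr j j0; lia.
case: ifP => // lt; apply/andP; split; last first.
  by apply/all_iotaP => i hi; apply: H => //; rewrite in_lamE //; lia.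
apply/all_iotaP => i hi; apply/implyP => /eqP E.
have hc : in_lam a i j.+1 by rewrite in_lamE //; lia.
have hc' : in_lam a i.-1 j.+1 by rewrite in_lamE //; lia.
have hb := in_lam_bounds hc.
have := H _ _ j0 hc'; rewrite prednK; last by lia.
case/orP => [|/eqP ->] //.
move/all_iotaP: pp => /(_ i.-1) pp; have /all_iotaP/(_ j.+1) := pp ltac:(lia).
by rewrite prednK ?hc /=; lia.
Qed.

Lemma vfillP f : reflect (vpp_shape a f /\ good (ent f)) (vfill f).
Proof.
apply: (iffP and3P) => [[S pp vc]|[S [G1 G2 G3]]].
  split=> //; split; last exact/vertex_condP.
  - move=> i j j0 hc; have hb := in_lam_bounds hc.
    by move/all_iotaP/(_ i ltac:(lia))/all_iotaP/(_ j ltac:(lia)): pp; rewrite hc; lia.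
  - move=> i j i0 hc; have hb := in_lam_bounds hc.
    by move/all_iotaP/(_ i ltac:(lia))/all_iotaP/(_ j ltac:(lia)): pp; rewrite hc; lia.
have pp : plane_partition a f.
  apply/all_iotaP => i hi; apply/all_iotaP => j hj.
  apply/andP; split; apply/implyP => hc; [apply: G1|apply: G2] => //; lia.
by split=> //; apply/vertex_condP.
Qed.

End Filling.
End Shape.

(** * Counting fillings by their set of values *)

(** [enum S] filters an increasing enumeration, so [enum_val] is the increasing bijection from ranks
    to values. *)
Lemma enum_val_ltn k (S : {set 'I_k}) (u u' : 'I_#|S|) :
  u < u' -> enum_val u < enum_val u'.
Proof.
move=> uu'; have x0 := enum_val u.
rewrite (enum_val_nth x0) (enum_val_nth x0 u').
have srt : sorted (fun x y : 'I_k => x < y) (enum S).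
  rewrite /enum_mem; apply: sorted_filter; first by move=> y x z; apply: ltn_trans.
  by have := iota_ltn_sorted 0 k; rewrite -val_enum_ord sorted_map enumT.
apply: (sorted_ltn_nth _ x0 srt) => //.
- by move=> y x z; apply: ltn_trans.
- by rewrite inE -cardE.
- by rewrite inE -cardE.
Qed.

Lemma enum_val_leq k (S : {set 'I_k}) (u u' : 'I_#|S|) :
  (enum_val u <= enum_val u') = (u <= u').
Proof.
case: (ltngtP u u') => [lt|lt|/val_inj ->]; last exact: leqnn.
  exact: ltnW (enum_val_ltn lt).
by apply/negbTE; rewrite -ltnNge; apply: enum_val_ltn.
Qed.

Section Count.
Variables (n : nat) (a : n.-tuple bool).

Definition cells : {set 'I_n * 'I_n} :=
  [set c : 'I_n * 'I_n | in_lam a (c.1 : nat).+1 (c.2 : nat).+1].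

Lemma card_cells : #|cells| = lsize a.
Proof.
rewrite -sum1_card /lsize big_add1 /= big_mkord.
under eq_bigl do rewrite inE.
rewrite -(pair_big_dep predT (fun i j : 'I_n => in_lam a i.+1 j.+1) (fun _ _ => 1)) /=.
apply: eq_bigr => i _; rewrite /in_lam ltn_ord /=.
rewrite (eq_bigl (fun j : 'I_n => j < lam a i.+1)) //.
by rewrite -(big_ord_widen n (fun=> 1) (lam_le a (ltn0Sn i))) sum1_card card_ord.
Qed.

Definition vals k (f : {ffun 'I_n * 'I_n -> option 'I_k}) : {set 'I_k} :=
  [set v | [exists c, f c == Some v]].

Lemma is_vppE k (f : {ffun 'I_n * 'I_n -> option 'I_k}) :
  is_vpp a f = vfill a f && (vals f == setT).
Proof.
rewrite /is_vpp /vfill -!andbA; do 3!congr (_ && _).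
apply/forallP/eqP => [H|H v]; first by apply/setP => v; rewrite !inE H.
by have := in_setT v; rewrite -H inE.
Qed.

Lemma vfill_relabel k k' (phi : 'I_k -> 'I_k')
    (f : {ffun 'I_n * 'I_n -> option 'I_k}) :
  (forall u v, (phi u <= phi v) = (u <= v)) ->
  vfill a [ffun c => omap phi (f c)] = vfill a f.
Proof.
move=> mono; set f' := finfun _.
have Es : vpp_shape a f' = vpp_shape a f.
  by apply: eq_forallb => c; rewrite ffunE; case: (f c).
have Ec (S : vpp_shape a f) i j i' j' : in_lam a i j -> in_lam a i' j' ->
    (ent f' i j <= ent f' i' j') = (ent f i j <= ent f i' j').
  move=> hc hd; have [c [Ei Ej]] := in_lam_ord hc; have [d [Ei' Ej']] := in_lam_ord hd.
  subst i j i' j'; move: hc hd; rewrite -!(shapeP _ _ S) !entE !ffunE.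
  by case: (f c) => // u _; case: (f d) => //= v _; apply: mono.
apply/vfillP/vfillP; rewrite Es => -[S G]; split=> //; apply: good_relabel G => *.
  by rewrite Ec.
by rewrite Ec.
Qed.

(** Replacing each value by its rank in S preserves all comparisons, hence [vfill], and makes every
    rank occur. *)
Lemma card_vfill_vals k (S : {set 'I_k}) :
  #|[set f : {ffun 'I_n * 'I_n -> option 'I_k} | vfill a f & vals f == S]|
  = p_a0 a #|S|.
Proof.
pose rel (f : {ffun 'I_n * 'I_n -> option 'I_#|S|}) :
  {ffun 'I_n * 'I_n -> option 'I_k} := [ffun c => omap enum_val (f c)].
have rel_inj : injective rel.
  move=> f g /ffunP E; apply/ffunP => c; have := E c; rewrite !ffunE.
  by case: (f c) (g c) => [u|] [v|] //= [] /enum_val_inj ->.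
rewrite /p_a0 -(card_imset _ rel_inj); apply: eq_card => g; rewrite !inE.
have vals_rel f : vals (rel f) = enum_val @: vals f.
  apply/setP => v; rewrite inE; apply/existsP/imsetP => [[c]|[u]].
    rewrite ffunE; case E: (f c) => [u|] // /eqP[<-]; exists u => //.
    by rewrite inE; apply/existsP; exists c; rewrite E.
  by rewrite inE => /existsP[c /eqP E] ->; exists c; rewrite ffunE E.
have enum_valT : enum_val @: [set: 'I_#|S|] = S.
  apply/setP => v; apply/imsetP/idP => [[u _ ->]|vS]; first exact: enum_valP.
  by exists (enum_rank_in vS v); rewrite ?enum_rankK_in.
apply/andP/imsetP => [[gv /eqP gS]|[f]]; last first.
  rewrite inE is_vppE => /andP[fv /eqP fT] ->.
  by rewrite vals_rel fT enum_valT vfill_relabel ?fv //; apply: enum_val_leq.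
pose f : {ffun 'I_n * 'I_n -> option 'I_#|S|} :=
  [ffun c => [pick u | g c == Some (enum_val u)]].
have E : g = rel f.
  apply/ffunP => c; rewrite !ffunE; case: pickP => [u /eqP //|no].
  case Ec: (g c) => [v|] //.
  have vS : v \in S by rewrite -gS inE; apply/existsP; exists c; rewrite Ec.
  by have := no (enum_rank_in vS v); rewrite enum_rankK_in // Ec eqxx.
exists f => //; rewrite inE is_vppE; apply/andP; split.
  by rewrite -(vfill_relabel f (@enum_val_leq _ S)) -/(rel f) -E.
apply/eqP; apply: (imset_inj (@enum_val_inj _ S)).
by rewrite enum_valT -vals_rel -E.
Qed.

Lemma card_vals k (f : {ffun 'I_n * 'I_n -> option 'I_k}) :
  vpp_shape a f -> #|vals f| <= lsize a.
Proof.
move=> /shapeP S; rewrite -card_cells.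
rewrite -(card_imset (vals f) (@Some_inj _)).
apply: leq_trans (leq_imset_card f cells); apply: subset_leq_card.
apply/subsetP => o /imsetP[v]; rewrite inE => /existsP[c /eqP E] ->.
by apply/imsetP; exists c => //; rewrite inE -S E.
Qed.

Lemma p_a0_eq0 k : lsize a < k -> p_a0 a k = 0.
Proof.
move=> lt; apply/eqP; rewrite cards_eq0 -subset0; apply/subsetP => f.
rewrite inE is_vppE => /andP[/vfillP[S _] /eqP fT].
by have := card_vals S; rewrite fT cardsT card_ord leqNgt lt.
Qed.

(** Fillings are sorted by their value set S. The contribution of S depends only on its size, which
    yields the binomial coefficient, and vanishes beyond |lambda|. *)
Lemma card_vfill k :
  #|[set f : {ffun 'I_n * 'I_n -> option 'I_k} | vfill a f]|
  = \sum_(j < (lsize a).+1) 'C(k, j) * p_a0 a j.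
Proof.
rewrite -sum1_card (partition_big (@vals k) predT) //=.
transitivity (\sum_(S : {set 'I_k}) p_a0 a #|S|).
  apply: eq_bigr => S _; rewrite -card_vfill_vals -sum1_card.
  by apply: eq_bigl => f; rewrite !inE.
rewrite [LHS](bigID (fun S : {set 'I_k} => #|S| < (lsize a).+1)) /=.
rewrite [X in _ + X]big1 ?addn0; last by move=> S; rewrite -leqNgt => /p_a0_eq0.
rewrite (partition_big (fun S : {set 'I_k} => inord #|S| : 'I_(lsize a).+1) predT) //=.
apply: eq_bigr => j _.
rewrite (eq_bigl (fun S : {set 'I_k} => #|S| == j)); last first.
  move=> S; apply/andP/eqP => [[lt /eqP <-]|->]; first by rewrite inordK.
  by rewrite ltn_ord inord_val.
rewrite (eq_bigr (fun=> p_a0 a j)); last by move=> S /eqP ->.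
rewrite sum_nat_const; congr (_ * _).
by rewrite -[X in 'C(X, _)](card_ord k) -card_draws; apply: eq_card => S; rewrite !inE.
Qed.
End Count.

(** * Distinct entries and shifted standard tableaux *)

Section Standard.
Variables (n : nat) (a : n.-tuple bool).
Notation N := (lsize a).
Implicit Types f T : {ffun 'I_n * 'I_n -> option 'I_N}.

Lemma vals_full_inj f : vpp_shape a f -> vals f = setT ->
  {in cells a &, injective f}.
Proof.
move=> /shapeP S fT; apply/imset_injP; rewrite eqn_leq leq_imset_card.
rewrite card_cells -[X in X <= _](card_ord N) -cardsT -(card_imset _ (@Some_inj _)) -fT.
apply: subset_leq_card; apply/subsetP => o /imsetP[v].
rewrite inE => /existsP[c /eqP E] ->.
by apply/imsetP; exists c => //; rewrite inE -S E.
Qed.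

Definition colkey (c : 'I_n * 'I_n) : nat := c.2 * n + c.1.

(** Cells are numbered backwards, column by column: the number of later cells decreases down each
    column and from each column to the next. *)
Definition colrank (c : 'I_n * 'I_n) : nat :=
  #|[set d in cells a | colkey c < colkey d]|.

Lemma colkey_inj : injective colkey.
Proof.
move=> [i j] [i' j'] E; have n0 : 0 < n by apply: leq_ltn_trans (ltn_ord i).
have := congr1 (modn^~ n) E; have := congr1 (divn^~ n) E.
rewrite /colkey /= !modnMDl !divnMDl // !divn_small // !modn_small // !addn0.
by move=> /val_inj -> /val_inj ->.
Qed.

Lemma colrank_anti c d : d \in cells a -> colkey c < colkey d ->
  colrank d < colrank c.
Proof.
move=> dc lt; apply: proper_card; apply/properP; split.
  by apply/subsetP => x; rewrite !inE => /andP[-> /(ltn_trans lt)].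
by exists d; rewrite inE ?dc // ltnn andbF.
Qed.

Lemma colrank_lt c : c \in cells a -> colrank c < N.
Proof.
move=> cc; rewrite -card_cells; apply: proper_card; apply/properP; split.
  by apply/subsetP => x; rewrite inE => /andP[].
by exists c; rewrite // inE ltnn andbF.
Qed.

(** The filling by [colrank] is a witness: column j+1 comes entirely after column j, so even
    e(i,j+1) < e(i+1,j). Positivity fixes the exact degree of the polynomial. *)
Lemma p_a0_gt0 : 0 < p_a0 a N.
Proof.
pose f : {ffun 'I_n * 'I_n -> option 'I_N} :=
  [ffun c => if c \in cells a then insub (colrank c) else None].
have fE c (cc : c \in cells a) : f c = Some (Ordinal (colrank_lt cc)).
  by rewrite ffunE cc (insubT (fun x => x < N) (colrank_lt cc)).
have S : vpp_shape a f.
  apply/shapeP => c; case: (boolP (c \in cells a)) => cc.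
    by rewrite fE; have := cc; rewrite inE => ->.
  by rewrite ffunE (negbTE cc); move: cc; rewrite inE => /negbTE ->.
have Ef c : c \in cells a -> ent f c.1.+1 c.2.+1 = colrank c.
  by move=> cc; rewrite entE fE.
have lt i j i' j' : in_lam a i j -> in_lam a i' j' ->
    (j < j') || ((j == j') && (i < i')) -> ent f i' j' < ent f i j.
  move=> hc hd; have [c [Ei Ej]] := in_lam_ord hc; have [d [Ei' Ej']] := in_lam_ord hd.
  subst i j i' j' => H; rewrite !Ef ?inE //; apply: colrank_anti; rewrite ?inE //.
  rewrite /colkey; case/orP: H => [H|/andP[/eqP[->] H]]; last by rewrite ltn_add2l.
  apply: (@leq_trans (c.2 * n + n)); first by rewrite ltn_add2l.
  rewrite addnC -mulSn; apply: leq_trans (leq_addr _ _).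
  by rewrite leq_mul2r orbC; move: H; rewrite ltnS => ->.
rewrite /p_a0 card_gt0; apply/set0Pn; exists f; rewrite inE is_vppE.
apply/andP; split; last first.
  rewrite eqEcard subsetT cardsT card_ord /= -[X in X <= _]card_cells.
  rewrite -(card_imset (vals f) (@Some_inj _)) -(@card_in_imset _ _ f).
    apply: subset_leq_card; apply/subsetP => o /imsetP[c cc ->].
    by rewrite fE //; apply/imsetP; eexists => //; rewrite inE; apply/existsP; exists c; rewrite fE.
  move=> c d cc dc; rewrite !fE // => -[E]; apply: colkey_inj.
  by case: (ltngtP (colkey c) (colkey d)) => // lt'; have := colrank_anti _ lt';
    rewrite E ltnn => /(_ ltac:(done)).
apply/vfillP; split=> //; split=> i j h0 hc.
- have hc' : in_lam a i j by apply: (in_lam_sub hc); have := in_lam_bounds hc; lia.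
  by apply: ltnW; apply: lt => //; lia.
- have hc' : in_lam a i j by apply: (in_lam_sub hc); have := in_lam_bounds hc; lia.
  by apply: ltnW; apply: lt => //; lia.
have hd := in_lam_antidiag h0 hc.
by apply/orP; left; apply: lt => //; lia.
Qed.

(* Cell (r, k) of the shifted shape corresponds to cell (k+1-r, n+1-k) of
   lambda; here in 0-indexed coordinates. *)
Definition of_shifted (c : 'I_n * 'I_n) : 'I_n * 'I_n :=
  (Ordinal (leq_ltn_trans (leq_subr c.1 c.2) (ltn_ord c.2)), rev_ord c.2).

Definition to_shifted (c : 'I_n * 'I_n) : 'I_n * 'I_n :=
  (Ordinal (leq_ltn_trans (leq_subr c.1 (rev_ord c.2)) (ltn_ord (rev_ord c.2))),
   rev_ord c.2).

Lemma to_shiftedK (c : 'I_n * 'I_n) : c.1 + c.2 < n -> of_shifted (to_shifted c) = c.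
Proof.
case: c => i j /= lt; congr pair; apply: val_inj => /=;
  by have := ltn_ord j; lia.
Qed.

Lemma of_shiftedK (c : 'I_n * 'I_n) : c.1 <= c.2 -> to_shifted (of_shifted c) = c.
Proof.
case: c => i j /= lt; congr pair; apply: val_inj => /=;
  by have := ltn_ord j; lia.
Qed.

(** Entries are carried over unchanged: a step down in the shifted shape is a step up a column of
    lambda, and a step right goes from (i,j+1) to (i+1,j). The guard tells where the truncated
    subtraction is exact. *)
Definition syt_of f : {ffun 'I_n * 'I_n -> option 'I_N} :=
  [ffun c : 'I_n * 'I_n => if c.1 <= c.2 then f (of_shifted c) else None].

Definition vpp_of T : {ffun 'I_n * 'I_n -> option 'I_N} :=
  [ffun c : 'I_n * 'I_n => if c.1 + c.2 < n then T (to_shifted c) else None].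

Lemma in_shiftedE r k : 0 < r <= k -> k <= n ->
  in_shifted a r k = in_lam a (k.+1 - r) (n.+1 - k).
Proof.
move=> Hr Hk; rewrite in_lamE; last by lia.
by rewrite /in_shifted; lia.
Qed.

(** Each a_j is at most 1, so lambda lies in a staircase, where the truncated subtractions of
    [to_shifted] are exact. *)
Lemma in_lam_triangle i j : in_lam a i j -> i + j <= n.+1.
Proof.
move=> hc; have := in_lam_bounds hc; case/and4P: hc => i0 iN j0 jl.
by have := apref_le a (n.+1 - i); rewrite -lam_apref; lia.
Qed.

(** This is [in_lam_antidiag] in shifted coordinates. Hence nonempty rows of the shifted shape are
    intervals ending at column n, and adjacent cells decide row monotonicity. *)
Lemma in_shifted_row r k : k < n -> in_shifted a r k -> in_shifted a r k.+1.
Proof.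
move=> kn h; have h' := h; case/and4P: h' => r0 rk _ _.
move: h; rewrite !in_shiftedE; try lia.
have -> : n.+1 - k = (n.+1 - k.+1).+1 by lia.
have -> : k.+2 - r = (k.+1 - r).+1 by lia.
by apply: in_lam_antidiag; lia.
Qed.

Lemma in_shifted_row_le r k k' : k <= k' <= n ->
  in_shifted a r k -> in_shifted a r k'.
Proof.
case/andP=> kk' k'n h; elim: k' kk' k'n => [|k' IH].
  by rewrite leqn0 => /eqP <-.
rewrite leq_eqVlt => /orP[/eqP <- //|lt] k'n.
by apply: in_shifted_row => //; apply: IH => //; apply: ltnW.
Qed.

Lemma syt_ofK f : vpp_shape a f -> vpp_of (syt_of f) = f.
Proof.
move/shapeP => S; apply/ffunP => -[i j]; rewrite ffunE /=; case: ifP => H.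
  by rewrite ffunE to_shiftedK // /to_shifted /= leq_subr.
case E: (f _) => [v|] //; exfalso.
by have := S (i, j); rewrite E => /esym/in_lam_triangle /=; lia.
Qed.

Lemma vpp_ofK T :
  (forall c : 'I_n * 'I_n, (T c != None) = in_shifted a c.1.+1 c.2.+1) ->
  syt_of (vpp_of T) = T.
Proof.
move=> S; apply/ffunP => -[r k]; rewrite ffunE /=; case: ifP => H.
  rewrite ffunE of_shiftedK // /=; case: ifP => // ?; exfalso.
  by have := ltn_ord k; lia.
case E: (T _) => [v|] //; exfalso.
by have := S (r, k); rewrite E => /esym/and4P[/= ? ? _ _]; lia.
Qed.

Lemma ent_syt_of f r k : 0 < r <= k -> k <= n ->
  ent (syt_of f) r k = ent f (k.+1 - r) (n.+1 - k).
Proof.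
move=> Hr Hk; have Hr' : r.-1 < n by lia. have Hk' : k.-1 < n by lia.
pose c := (Ordinal Hr', Ordinal Hk') : 'I_n * 'I_n.
have -> : r = c.1.+1 by rewrite /=; lia.
have -> : k = c.2.+1 by rewrite /=; lia.
rewrite entE ffunE; case: ifP => [_|]; last by rewrite /=; lia.
rewrite -entE /=; congr ent; lia.
Qed.

(** Rows of the tableau give e(i,j+1) < e(i+1,j), columns give e(i+1,j) < e(i,j), and together they
    give the decrease along the rows of lambda. *)
Lemma good_of_syt (e t : nat -> nat -> nat) :
  (forall i j, in_lam a i j -> e i j = t (n.+2 - (i + j)) (n.+1 - j)) ->
  (forall r k k', in_shifted a r k -> in_shifted a r k' -> k < k' ->
     t r k < t r k') ->
  (forall k r r', in_shifted a r k -> in_shifted a r' k -> r < r' ->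
     t r k < t r' k) -> good a e.
Proof.
move=> E Trow Tcol.
have sh i j : in_lam a i j -> in_shifted a (n.+2 - (i + j)) (n.+1 - j).
  move=> hc; have := in_lam_triangle hc; have := in_lam_bounds hc => ? ?.
  rewrite in_shiftedE; try lia.
  have -> : (n.+1 - j).+1 - (n.+2 - (i + j)) = i by lia.
  by have -> : n.+1 - (n.+1 - j) = j by lia.
have Hcol i j : 0 < i -> in_lam a i.+1 j -> e i.+1 j <= e i j.
  move=> i0 hc; have hc' : in_lam a i j.
    by apply: (in_lam_sub hc); have := in_lam_bounds hc; lia.
  have := in_lam_triangle hc => ?.
  by rewrite !E //; apply/ltnW/Tcol; [exact: sh|exact: sh|lia].
have Hd i j : 0 < j -> in_lam a i j.+1 -> e i j.+1 < e i.+1 j.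
  move=> j0 hc; have hd := in_lam_antidiag j0 hc; have := in_lam_triangle hc => ?.
  rewrite !E //; have Er : n.+2 - (i.+1 + j) = n.+2 - (i + j.+1) by lia.
  by rewrite Er; apply: Trow; [exact: sh|rewrite -Er; exact: sh|lia].
split=> // i j j0 hc; last by rewrite Hd.
have hd := in_lam_antidiag j0 hc; apply: leq_trans (ltnW (Hd _ _ j0 hc)) _.
by apply: Hcol => //; have := in_lam_bounds hc; lia.
Qed.

(** When all |lambda| values occur, the entries are distinct by [vals_full_inj]. Decrease down the
    columns becomes strict, and the equality allowed by the third condition of [good] is
    excluded. *)
Lemma syt_of_is_syt f : is_vpp a f -> is_syt a (syt_of f).
Proof.
rewrite is_vppE => /andP[/vfillP[S [G1 G2 G3]] /eqP fT].
have finj := vals_full_inj S fT; move/shapeP: (S) => S'.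
have Sh (c : 'I_n * 'I_n) : (syt_of f c != None) = in_shifted a c.1.+1 c.2.+1.
  rewrite ffunE; case: ifP => H; last by rewrite /in_shifted /= ltnS H.
  rewrite S' /= in_shiftedE ?ltnS //.
  by congr in_lam; have := ltn_ord c.2; lia.
have ent_inj i j i' j' : in_lam a i j -> in_lam a i' j' ->
    ent f i j = ent f i' j' -> i = i' /\ j = j'.
  move=> hc hd; have [c [Ei Ej]] := in_lam_ord hc; have [d [Ei' Ej']] := in_lam_ord hd.
  subst i j i' j'; rewrite !entE => E.
  suff -> : c = d by [].
  apply: finj; rewrite ?inE //; move: E; move: (hc) (hd); rewrite -!S'.
  by case: (f c) => // u _; case: (f d) => // v _ /= /val_inj ->.
have hcol i j i' : in_lam a i' j -> 0 < i < i' -> ent f i' j < ent f i j.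
  move=> hd; case/andP=> i0 lt.
  elim: i' lt hd => // i' IH; rewrite ltnS leq_eqVlt => lt hd.
  have hm : in_lam a i' j by apply: (in_lam_sub hd); have := in_lam_bounds hd; lia.
  have st : ent f i'.+1 j < ent f i' j.
    rewrite ltn_neqAle G2 ?andbT //; last by lia.
    by apply/eqP => /ent_inj [] //; lia.
  by case/orP: lt => [/eqP -> //|lt]; apply: ltn_trans st (IH lt hm).
have hdiag i j : 0 < j -> in_lam a i j.+1 -> ent f i j.+1 < ent f i.+1 j.
  move=> j0 hc; case/orP: (G3 _ _ j0 hc) => // /eqP /ent_inj.
  by case; rewrite ?hc //; [apply: (in_lam_sub hc); have := in_lam_bounds hc|]; lia.
apply/and5P; split.
- by apply/forallP => c; rewrite Sh.
- apply/forallP => v; have : v \in vals f by rewrite fT.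
  rewrite inE => /existsP[c /eqP E]; apply/existsP; exists (to_shifted c).
  have := S' c; rewrite E => /esym/in_lam_triangle tr.
  by rewrite ffunE to_shiftedK ?E ?leq_subr //; lia.
- apply/forallP => c; apply/forallP => d; apply/implyP => hc; apply/implyP => /eqP Ecd.
  have hd := hc; rewrite Ecd in hd; move: hc hd Ecd; rewrite !ffunE.
  case: ifP => // hc c0; case: ifP => // hd d0 /finj.
  rewrite !inE -!S' c0 d0 => /(_ isT isT) Ecd.
  by rewrite -(of_shiftedK hc) Ecd of_shiftedK.
- apply/all_iotaP => r hr; apply/all_iotaP => k hk; apply/all_iotaP => k' hk'.
  apply/implyP => /andP[/andP[h h'] lt].
  have step u : in_shifted a r u -> u < n -> ent (syt_of f) r u < ent (syt_of f) r u.+1.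
    move=> hu un; case/and4P: (hu) => ????; move: hu.
    rewrite in_shiftedE ?ent_syt_of; try lia.
    have -> : n.+1 - u = (n.+1 - u.+1).+1 by lia.
    have -> : u.+2 - r = (u.+1 - r).+1 by lia.
    by apply: hdiag; lia.
  elim: k' lt hk' {h'} => // k' IH; rewrite ltnS leq_eqVlt => lt hk'.
  have hm : in_shifted a r k' by apply: in_shifted_row_le h; lia.
  case/orP: lt => [/eqP ->|lt]; first by apply: step => //; lia.
  by apply: ltn_trans (IH lt _) (step _ hm _); lia.
- apply/all_iotaP => k hk; apply/all_iotaP => r hr; apply/all_iotaP => r' hr'.
  apply/implyP => /andP[/andP[h h'] lt].
  have := h; have := h'; case/and4P: h => ????; case/and4P: h' => ????.
  rewrite !in_shiftedE; try lia.
  by move=> hd hc; rewrite !ent_syt_of; try lia; apply: hcol => //; lia.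
Qed.

Lemma vpp_of_is_vpp T : is_syt a T -> is_vpp a (vpp_of T).
Proof.
case/and5P => /forallP S /forallP V _ /all_iotaP Trow /all_iotaP Tcol.
have S' (c : 'I_n * 'I_n) : (T c != None) = in_shifted a c.1.+1 c.2.+1.
  exact: (eqP (S c)).
have Es : syt_of (vpp_of T) = T by apply: vpp_ofK.
rewrite is_vppE; apply/andP; split; last first.
  apply/eqP/setP => v; rewrite !inE; case/existsP: (V v) => -[r k] /eqP E.
  apply/existsP; exists (of_shifted (r, k)).
  have := S' (r, k); rewrite E => /esym/and4P[_ lt _ _].
  rewrite ffunE of_shiftedK ?E //=; case: ifP => // ?; exfalso.
  by move: lt => /=; have := ltn_ord k; lia.
apply/vfillP; split.
  apply/shapeP => c; rewrite ffunE; case: ifP => H; last first.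
    by apply/esym/negbTE/negP => /in_lam_triangle; lia.
  rewrite S' /= in_shiftedE; try lia.
  by congr in_lam; lia.
apply: (@good_of_syt _ (ent T)).
- move=> i j hc; have := in_lam_triangle hc; have := in_lam_bounds hc => ? ?.
  rewrite -Es ent_syt_of ?Es; try lia.
  by congr ent; lia.
- move=> r k k' h h' lt; case/and4P: (h) => ????; case/and4P: (h') => ????.
  move/all_iotaP: (Trow r ltac:(lia)) => /(_ k ltac:(lia)) /all_iotaP /(_ k' ltac:(lia)).
  by rewrite h h' lt.
- move=> k r r' h h' lt; case/and4P: (h) => ????; case/and4P: (h') => ????.
  move/all_iotaP: (Tcol k ltac:(lia)) => /(_ r ltac:(lia)) /all_iotaP /(_ r' ltac:(lia)).
  by rewrite h h' lt.
Qed.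

Lemma p_a0_syt : p_a0 a N = syt_count a.
Proof.
have shf f : is_vpp a f -> vpp_shape a f by case/andP.
have shT T : is_syt a T ->
    forall c : 'I_n * 'I_n, (T c != None) = in_shifted a c.1.+1 c.2.+1.
  by case/andP => /forallP S _ c; apply: (eqP (S c)).
apply/eqP; rewrite eqn_leq; apply/andP; split.
  rewrite /p_a0 -(@card_in_imset _ _ syt_of).
    apply: subset_leq_card; apply/subsetP => T /imsetP[f]; rewrite inE => fv ->.
    by rewrite inE syt_of_is_syt.
  move=> f g; rewrite !inE => /shf fv /shf gv /(congr1 vpp_of).
  by rewrite !syt_ofK.
rewrite /syt_count -(@card_in_imset _ _ vpp_of).
  apply: subset_leq_card; apply/subsetP => f /imsetP[T]; rewrite inE => Tv ->.
  by rewrite inE vpp_of_is_vpp.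
move=> f g; rewrite !inE => /shT fv /shT gv /(congr1 syt_of).
by rewrite !vpp_ofK.
Qed.

End Standard.

(** * Binomial sums as polynomials *)

Local Open Scope ring_scope.

(** The falling factorial of X + 1 with j factors, shifted by one because entries from 0 to m take
    m+1 values. *)
Definition ffact_poly (j : nat) : {poly rat} :=
  \prod_(x <- [seq i%:R - 1 | i <- iota 0 j]) ('X - x%:P).

Lemma horner_ffact_poly (j m : nat) : (ffact_poly j).[m%:R] = (m.+1 ^_ j)%:R.
Proof.
elim: j => [|j IH]; first by rewrite /ffact_poly /= big_nil hornerC ffactn0.
rewrite /ffact_poly -addn1 iotaD map_cat big_cat /= big_seq1 add0n.
rewrite hornerM -/(ffact_poly j) IH hornerXsubC addn1 ffactnSr natrM.
case: (leqP j m.+1) => [le|lt]; last by rewrite ffact_small // !mul0r.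
by rewrite natrB // -natr1; congr (_ * _); ring.
Qed.

Lemma size_ffact_poly j : size (ffact_poly j) = j.+1.
Proof. by rewrite size_prod_XsubC size_map size_iota. Qed.

(** The j-th summand is p(j)/j! times a monic polynomial of degree j. Only the last one reaches
    degree N, and its coefficient is nonzero because p(N) is positive. *)
Lemma binomial_sum_poly (N : nat) (p : nat -> nat) : (0 < p N)%N ->
  exists P : {poly rat},
    [/\ forall m : nat, P.[m%:R] = (\sum_(j < N.+1) 'C(m.+1, j) * p j)%:R,
        size P = N.+1 & (N`!)%:R * P`_N = (p N)%:R].
Proof.
move=> pN; pose c j : rat := (p j)%:R / (j`!)%:R.
have fact0 j : (j`!)%:R != 0 :> rat by rewrite pnatr_eq0 -lt0n fact_gt0.
have cN : c N != 0 by rewrite mulf_neq0 ?invr_eq0 ?fact0 // pnatr_eq0 -lt0n.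
pose Q := \sum_(j < N) c j *: ffact_poly j.
have sQ : (size Q <= N)%N.
  apply: leq_trans (size_sum _ _ _) _; apply/bigmax_leqP => j _.
  by apply: leq_trans (size_scale_leq _ _) _; rewrite size_ffact_poly.
have sT : size (c N *: ffact_poly N) = N.+1 by rewrite size_scale // size_ffact_poly.
exists (\sum_(j < N.+1) c j *: ffact_poly j); split.
- move=> m; rewrite horner_sum natr_sum; apply: eq_bigr => j _.
  rewrite hornerZ horner_ffact_poly -bin_ffact !natrM /c.
  by field; apply: fact0.
- by rewrite big_ord_recr /= -/Q addrC size_polyDl sT // ltnS.
rewrite big_ord_recr /= -/Q coefD nth_default // add0r coefZ.
have /monicP : ffact_poly N \is monic by apply: monic_prod_XsubC.
rewrite lead_coefE size_ffact_poly /= => ->.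
by rewrite /c; field; apply: fact0.
Qed.

(** * Vertices of the marked order polytope *)

Lemma norm_gap (R : realFieldType) (s : seq R) :
  exists2 eps : R, 0 < eps & forall x, x \in s -> x != 0 -> eps <= `|x|.
Proof.
elim: s => [|x s [e e0 IH]]; first by exists 1.
case: (eqVneq x 0) => [->|x0].
  by exists e => // y; rewrite inE => /orP[/eqP ->|/IH //]; rewrite eqxx.
exists (Num.min e `|x|); first by rewrite lt_min e0 normr_gt0.
move=> y; rewrite inE => /orP[/eqP ->|ys] y0; first by rewrite ge_min lexx orbT.
by rewrite ge_min IH.
Qed.

Section Arrays.
Variables (R : realFieldType) (n m : nat) (a : n.-tuple bool).
Implicit Types g y z : nat -> nat -> R.

(** For a flow, g(i,0) is all that leaves row i downwards, hence the supply of the rows up to i. Row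
    0 and column m+1 are padding. *)
Definition marked_array g : Prop :=
  [/\ forall j, (j <= m.+1)%N -> g 0%N j = 0,
      forall i, (i <= n)%N -> g i 0%N = (apref a i)%:R,
      forall i, (i <= n)%N -> g i m.+1 = 0,
      forall i j, (i <= n)%N -> (j <= m)%N -> g i j.+1 <= g i j
    & forall i j, (i < n)%N -> (j <= m.+1)%N -> g i j <= g i.+1 j].

(* Every level set of g meets each row in an interval; attachedness says that
   this interval reaches column 0 or touches the same level set in the
   previous row, so that every cell is connected to a marked one. *)
Definition attached g : Prop :=
  forall i j, (i < n)%N -> (j <= m.+1)%N ->
    exists2 j0, (j0 <= m.+1)%N &
      g i.+1 j0 = g i.+1 j /\ (j0 = 0%N \/ g i j0 = g i.+1 j).

Lemma marked_row g i j j' : marked_array g -> (i <= n)%N ->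
  (j <= j' <= m.+1)%N -> g i j' <= g i j.
Proof.
case=> _ _ _ H _ iN /andP[jj' j'm]; elim: j' jj' j'm => [|j' IH].
  by rewrite leqn0 => /eqP <-.
rewrite leq_eqVlt => /orP[/eqP <- //|lt] j'm.
by apply: le_trans (H _ _ iN _) (IH lt (ltnW j'm)).
Qed.

Lemma convex_tie (t y1 y2 z1 z2 : R) : 0 < t < 1 -> y1 <= y2 -> z1 <= z2 ->
  t * y1 + (1 - t) * z1 = t * y2 + (1 - t) * z2 -> y1 = y2.
Proof.
move=> /andP[t0 t1] hy hz E; apply/eqP; rewrite eq_le hy /= leNgt.
apply/negP => lt; have h1 : 0 < t * (y2 - y1) by rewrite mulr_gt0 // subr_gt0.
have h2 : 0 <= (1 - t) * (z2 - z1) by rewrite mulr_ge0 // subr_ge0 // ltW.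
by lra.
Qed.

(** By [convex_tie], a tie of g between cells whose order is prescribed is also a tie of y.
    Attachment links each cell by such ties to column 0 or to the previous row, so induction on rows
    reaches the marks. *)
Lemma attached_rigid g y z t : attached g -> marked_array g ->
  marked_array y -> marked_array z -> 0 < t < 1 ->
  (forall i j, (i <= n)%N -> (j <= m.+1)%N -> g i j = t * y i j + (1 - t) * z i j) ->
  forall i j, (i <= n)%N -> (j <= m.+1)%N -> y i j = g i j.
Proof.
move=> att gok yok zok t01 E.
case: (gok) => g0 gA _ _ _; case: (yok) => y0 yA _ _ yc; case: (zok) => _ _ _ _ zc.
elim=> [|i IH] j iN jm; first by rewrite y0 // g0.
have row u v : (u <= v <= m.+1)%N -> g i.+1 u = g i.+1 v -> y i.+1 u = y i.+1 v.
  move=> uv; rewrite !E //; try lia; move/esym => Euv; apply/esym.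
  apply: convex_tie t01 _ _ Euv; exact: marked_row.
have [j0 j0m [Ej H]] := att i j iN jm.
have -> : y i.+1 j = y i.+1 j0.
  by case: (leqP j j0) => le; [apply: row|apply/esym; apply: row];
    rewrite ?Ej // ?jm ?j0m ?andbT // ltnW.
rewrite -Ej; case: H => [->|H]; first by rewrite yA // gA.
have gE : g i j0 = g i.+1 j0 by rewrite H.
rewrite -gE -IH //; last exact: ltnW.
apply/esym; apply: convex_tie t01 (yc _ _ iN j0m) (zc _ _ iN j0m) _.
by rewrite -!E // ltnW.
Qed.

(** All cells of value v in the rows after i move together by s. They avoid the marks, since v is
    nonzero and strictly below the mark of row i+1, and none in row i+1 lies under an equal cell of
    row i. *)
Lemma detached_perturb g i j : marked_array g -> (i < n)%N -> (j <= m.+1)%N ->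
  (forall j0, (j0 <= m.+1)%N -> g i.+1 j0 = g i.+1 j ->
     j0 <> 0%N /\ g i j0 <> g i.+1 j) ->
  exists2 eps : R, 0 < eps & forall s : R, `|s| = eps ->
    marked_array (fun p q => g p q + s *+ ((i < p)%N && (g p q == g i.+1 j))).
Proof.
move=> gok iN jm det; case: (gok) => g0 gA gm gr gc; set v := g i.+1 j in det *.
have [e e0 gap] := norm_gap [seq g p q - v | p <- iota 0 n.+1, q <- iota 0 m.+2].
have {}gap p q : (p <= n)%N -> (q <= m.+1)%N -> g p q != v -> e <= `|g p q - v|.
  move=> pn qm ne; apply: gap; last by rewrite subr_eq0.
  by apply/allpairsP; exists (p, q); rewrite !mem_iota !ltnS.
have vA : v != (apref a i.+1)%:R.
  by apply/eqP => E; case: (det 0%N) => //; rewrite gA.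
have v0 : v != 0.
  apply/eqP => E; have [|_] := det m.+1 (leqnn _); first by rewrite gm.
  by rewrite gm ?E // ltnW.
have vlt : v < (apref a i.+1)%:R.
  by rewrite lt_neqAle vA -gA //; apply: marked_row.
exists e => // s se.
have sb : - e <= s <= e by rewrite -ler_norml se.
(* Ties at v move together. In a strict inequality with one end equal to v, that end moves by at
   most e while the other is at distance at least e. *)
have cmp (x w : R) : x <= w -> (x != v -> e <= `|x - v|) ->
    (w != v -> e <= `|w - v|) -> forall b c : bool, (b -> x = v) -> (c -> w = v) ->
    (x = v -> w = v -> b = c) -> x + s *+ b <= w + s *+ c.
  move=> xw gx gw [] [] bx cw H; rewrite ?mulr1n ?mulr0n ?addr0 ?lerD2r //.
    move/(_ isT): bx => E; subst x; case: (eqVneq w v) => [wv|/gw].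
      by have := H erefl wv.
    by rewrite ger0_norm ?subr_ge0 //; lra.
  move/(_ isT): cw => E; subst w; case: (eqVneq x v) => [xv|/gx].
    by have := H xv erefl.
  by rewrite ler0_norm ?subr_le0 //; lra.
split.
- by move=> q qm; rewrite ltn0 mulr0n addr0 g0.
- move=> p pn; rewrite gA //; case: (boolP (_ && _)) => [/andP[ip /eqP E]|_].
    by have := leq_apref a ip; rewrite -(ler_nat R); lra.
  by rewrite mulr0n addr0.
- by move=> p pn; rewrite gm // eq_sym (negbTE v0) andbF mulr0n addr0.
- move=> p q pn qm; apply: cmp; rewrite ?gr //.
  + by move=> ?; apply: gap => //.
  + by move=> ?; apply: gap => //; apply: leqW.
  + by case/andP=> _ /eqP.
  + by case/andP=> _ /eqP.
  + by move=> -> ->.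
- move=> p q pn qm; apply: cmp; rewrite ?gc //.
  + by move=> ?; apply: gap => //; apply: ltnW.
  + by move=> ?; apply: gap.
  + by case/andP=> _ /eqP.
  + by case/andP=> _ /eqP.
  move=> E1 E2; rewrite E1 E2 eqxx !andbT.
  (* For p = i the lower cell would move and the upper one stay; detachment excludes a tie at v
     there. *)
  case: (ltngtP i p) => [lt|lt|E]; [by rewrite ltnW| |].
    by rewrite ltnS leqNgt lt.
  by subst p; case: (det q qm E2) => _ /(_ E1).
Qed.

(** Following attachments from row to row ends at a mark, and marks are natural numbers. *)
Lemma attached_nat g : marked_array g -> attached g ->
  forall i j, (i <= n)%N -> (j <= m.+1)%N -> exists k : nat, g i j = k%:R.
Proof.
case=> g0 gA _ _ _ att; elim=> [|i IH] j iN jm; first by exists 0%N; rewrite g0.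
have [j0 j0m [<- [->|H]]] := att i j iN jm; first by exists (apref a i.+1); rewrite gA.
have [k Ek] := IH j0 (ltnW iN) j0m.
by exists k; rewrite -Ek H.
Qed.

End Arrays.

Local Close Scope ring_scope.

(** * Attached integral arrays and plane partitions *)

Lemma eq_from_leq (x y : nat) : (forall v, 0 < v -> (v <= x) = (v <= y)) -> x = y.
Proof.
move=> H; apply/eqP; rewrite eqn_leq; apply/andP; split.
  by case: (posnP x) => [-> //|x0]; rewrite -H.
by case: (posnP y) => [-> //|y0]; rewrite H.
Qed.

Section Levels.
Variables (n m : nat) (a : n.-tuple bool).
Implicit Types e h : nat -> nat -> nat.

Definition bounded e := forall i j, in_lam a i j -> e i j <= m.

(* The entries of row n+1-i of the plane partition are the columns of the
   vertical edges used in row i of the grid; levels e i j counts those that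
   are at least j. *)
Definition levels e (i j : nat) : nat :=
  count (fun v => in_lam a (n.+1 - i) v && (j <= e (n.+1 - i) v)) (iota 1 n).

Lemma good_row e r v v' : good a e -> in_lam a r v' -> 0 < v <= v' ->
  e r v' <= e r v.
Proof.
move=> [G _ _] h /andP[v0 le]; elim: v' le h => [|v' IH]; first by rewrite leqn0 => /eqP ->.
rewrite leq_eqVlt => /orP[/eqP <- //|le] h.
apply: leq_trans (IH le _); first by apply: G => //; lia.
by apply: (in_lam_sub h); have := in_lam_bounds h; lia.
Qed.

Lemma in_lam_row i v : i <= n -> in_lam a (n.+1 - i) v = (0 < v <= apref a i).
Proof.
move=> iN; rewrite /in_lam lam_apref subKn; last by lia.
case: i iN => [|i] iN; first by rewrite apref0; lia.
by lia.
Qed.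

Lemma leq_levels e i j v : good a e -> 0 < v ->
  (v <= levels e i j) = in_lam a (n.+1 - i) v && (j <= e (n.+1 - i) v).
Proof.
move=> ge v0; case: (leqP v n) => vn.
  rewrite /levels (@count_iota_down _ n v) ?v0 // => u w u0 uw /andP[h le].
  have -> /= : in_lam a (n.+1 - i) u.
    by apply: (in_lam_sub h); have := in_lam_bounds h; lia.
  by apply: leq_trans le _; apply: good_row => //; rewrite u0.
transitivity false.
  apply/negbTE; rewrite -ltnNge; apply: leq_ltn_trans vn.
  by rewrite -[X in _ <= X](size_iota 1) count_size.
by apply/esym/negbTE/negP => /andP[/in_lam_bounds]; lia.
Qed.

Section Good.
Variables (R : realFieldType) (e : nat -> nat -> nat).
Hypotheses (ge : good a e) (be : bounded e).

Lemma levels_apref i : i <= n -> levels e i 0 = apref a i.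
Proof.
move=> iN; apply: eq_from_leq => v v0.
by rewrite leq_levels // in_lam_row // v0 andbT.
Qed.

Lemma levels_end i : levels e i m.+1 = 0.
Proof.
apply: eq_from_leq => v v0; rewrite leq_levels // leqn0 gtn_eqF //.
by apply/negbTE/negP => /andP[/be]; lia.
Qed.

Lemma leq_levels_row i j j' : j <= j' -> levels e i j' <= levels e i j.
Proof.
by move=> jj'; apply: sub_count => v /andP[-> le]; apply: leq_trans le.
Qed.

Lemma leq_levels_col i j : i < n -> levels e i j <= levels e i.+1 j.
Proof.
move=> iN; apply: sub_count => v /andP[h le].
have E : n.+1 - i = (n.+1 - i.+1).+1 by lia.
rewrite E in h le; have [_ G _] := ge.
rewrite (leq_trans le) ?G ?andbT //; try lia.
by apply: (in_lam_sub h); have := in_lam_bounds h; lia.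
Qed.

Lemma levels_marked : marked_array m a (fun i j => (levels e i j)%:R%R : R).
Proof.
split.
- move=> j _; have := leq_levels_row 0 (leq0n j); rewrite levels_apref // apref0.
  by rewrite leqn0 => /eqP ->.
- by move=> i iN; rewrite levels_apref.
- by move=> i iN; rewrite levels_end.
- by move=> i j _ _; rewrite ler_nat leq_levels_row.
- by move=> i j iN _; rewrite ler_nat leq_levels_col.
Qed.

(** Let v, the level at (i+1,j), be strictly between 0 and the mark of its row, and r = n-i. The
    first column of row i+1 at level v is e(r,v+1)+1, and row i has level v there once e(r,v+1) <
    e(r+1,v). This is the third condition of [good]: its alternative e(r,v+1) = e(r,v) would leave
    no column at level v. *)
Lemma levels_attached : attached n m (fun i j => (levels e i j)%:R%R : R).
Proof.
move=> i j iN jm; set v := levels e i.+1 j.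
case: (posnP v) => [v0|v0].
  exists m.+1 => //; split; first by rewrite levels_end v0.
  by right; rewrite levels_end v0.
have va : v <= apref a i.+1 by rewrite -levels_apref // leq_levels_row.
case: (eqVneq v (apref a i.+1)) => [E|ne].
  by exists 0 => //; split; [rewrite levels_apref // -E|left].
set r := n.+1 - i.+1.
have h1 : in_lam a r v.+1 by rewrite in_lam_row //; lia.
have h := in_lam_antidiag v0 h1.
have Er : r.+1 = n.+1 - i by rewrite /r; lia.
have := leqnn v; rewrite {2}/v leq_levels // => /andP[hv jv].
have : ~~ (v.+1 <= levels e i.+1 j) by rewrite ltnn.
rewrite leq_levels // -/r h1 /= -ltnNge => jv1.
have [_ _ G] := ge; have lt : e r v.+1 < e r.+1 v.
  by case/orP: (G _ _ v0 h1) => // /eqP E; move: jv1; rewrite E ltnNge jv.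
have E1 : levels e i.+1 (e r v.+1).+1 = v.
  apply/eqP; rewrite eqn_leq; apply/andP; split; last first.
    by rewrite leq_levels // hv; apply: leq_trans jv.
  by rewrite leqNgt leq_levels // -/r h1 /= ltnn.
exists (e r v.+1).+1; first by apply: leq_trans jm.
split; first by rewrite E1.
right; congr (_%:R)%R; apply/eqP; rewrite eqn_leq; apply/andP; split.
  by apply: leq_trans (leq_levels_col _ iN) _; rewrite E1.
by rewrite leq_levels // -Er h.
Qed.

Lemma exists_fill : exists2 f : {ffun 'I_n * 'I_n -> option 'I_m.+1},
  vfill a f & forall i j, in_lam a i j -> ent f i j = e i j.
Proof.
pose f : {ffun 'I_n * 'I_n -> option 'I_m.+1} :=
  [ffun c : 'I_n * 'I_n => if in_lam a c.1.+1 c.2.+1 then Some (inord (e c.1.+1 c.2.+1)) else None].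
have fE i j : in_lam a i j -> ent f i j = e i j.
  move=> h; have [c [Ei Ej]] := in_lam_ord h; subst i j.
  by rewrite entE ffunE h /= inordK // ltnS be.
exists f => //; apply/vfillP; split.
  by apply/shapeP => c; rewrite ffunE; case: ifP.
by apply: good_relabel ge => *; rewrite !fE.
Qed.

End Good.

Lemma eq_levels e e' : (forall i j, in_lam a i j -> e i j = e' i j) ->
  forall i j, levels e i j = levels e' i j.
Proof.
by move=> E i j; apply: eq_count => v /=; case: (boolP (in_lam _ _ _)) => // /E ->.
Qed.

Lemma levels_inj (f f' : {ffun 'I_n * 'I_n -> option 'I_m.+1}) :
  vfill a f -> vfill a f' ->
  (forall i j, i <= n -> j <= m.+1 -> levels (ent f) i j = levels (ent f') i j) ->
  f = f'.
Proof.
move=> /vfillP[S G] /vfillP[S' G'] E; apply/ffunP => c.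
have := shapeP _ _ S c; have := shapeP _ _ S' c.
case: (boolP (in_lam _ _ _)) => [h|_]; last by case: (f c) (f' c) => [?|] [?|].
have Ee : ent f c.1.+1 c.2.+1 = ent f' c.1.+1 c.2.+1.
  have hb := in_lam_bounds h; apply: eq_from_leq => j _.
  case: (leqP j m.+1) => jm; last first.
    by have := ent_lt f c.1.+1 c.2.+1 (ltn0Sn m);
      have := ent_lt f' c.1.+1 c.2.+1 (ltn0Sn m); lia.
  have := E (n.+1 - c.1.+1) j ltac:(lia) jm => El.
  have := congr1 (leq c.2.+1) El; rewrite /= !leq_levels // subKn; last by lia.
  by rewrite h.
move: Ee; rewrite !entE; case: (f c) (f' c) => [u|] [u'|] //= E' _ _.
by congr Some; apply: val_inj.
Qed.

(** The rows of h are conjugated back into the rows of e. Monotonicity of h gives the decrease of e,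
    and attachment gives the third condition of [good]. *)
Lemma levels_surj (R : realFieldType) h :
  marked_array m a (fun i j => (h i j)%:R%R : R) ->
  attached n m (fun i j => (h i j)%:R%R : R) ->
  exists e, [/\ good a e, bounded e
    & forall i j, i <= n -> j <= m.+1 -> levels e i j = h i j].
Proof.
move=> hok att.
have nat_inj : injective (fun k : nat => k%:R%R : R).
  by move=> u v /eqP; rewrite eqr_nat => /eqP.
have hrow i j j' : i <= n -> j <= j' <= m.+1 -> h i j' <= h i j.
  by move=> iN jj'; have := marked_row hok iN jj'; rewrite ler_nat.
case: hok => h0 hA hm _ hc.
have {}h0 j : j <= m.+1 -> h 0 j = 0 by move=> ?; apply: nat_inj; apply: h0.
have {}hA i : i <= n -> h i 0 = apref a i by move=> ?; apply: nat_inj; apply: hA.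
have {}hm i : i <= n -> h i m.+1 = 0 by move=> ?; apply: nat_inj; apply: hm.
have {}hc i j : i < n -> j <= m.+1 -> h i j <= h i.+1 j.
  by move=> ? ?; rewrite -(ler_nat R); apply: hc.
pose e r v := count (fun j => v <= h (n.+1 - r) j) (iota 1 m).
have eE i j v : i <= n -> j <= m.+1 -> in_lam a (n.+1 - i) v ->
    (j <= e (n.+1 - i) v) = (v <= h i j).
  move=> iN jm hv; have := hv; rewrite in_lam_row // => /andP[v0 va].
  rewrite /e subKn; last by lia.
  case: j jm => [|j] jm; first by rewrite hA.
  case: (eqVneq j m) => [->|ne].
    rewrite hm // leqNgt ltnS -[X in _ <= X](size_iota 1) count_size /=.
    by rewrite leqNgt v0.
  (* h is only known to be antitone up to column m+1, hence the cut-off *)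
  rewrite -(@eq_in_count _ (fun j => (j <= m) && (v <= h i j))); last first.
    by move=> u; rewrite mem_iota => hu; have -> : u <= m by lia.
  rewrite count_iota_down; first by have -> : j < m by lia.
    move=> u w u0 uw /andP[wm le]; rewrite (leq_trans uw wm) /=.
    by apply: leq_trans le _; apply: hrow => //; rewrite uw leqW.
  by lia.
have be : bounded e.
  by move=> i j _; rewrite /e -[X in _ <= X](size_iota 1) count_size.
have Ei r v : in_lam a r v -> exists2 i, r = n.+1 - i & i <= n.
  by move/in_lam_bounds => hb; exists (n.+1 - r); [rewrite subKn|]; lia.
have row r v : 0 < v -> in_lam a r v.+1 -> e r v.+1 <= e r v.
  move=> v0 hv; have [i Er iN] := Ei _ _ hv; rewrite Er in hv *.
  have hv' : in_lam a (n.+1 - i) v.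
    by apply: (in_lam_sub hv); have := in_lam_bounds hv; lia.
  have eb := leqW (be _ _ hv).
  by rewrite eE //; apply: ltnW; rewrite -eE.
have ge : good a e.
  split=> // [r v r0 hv|r v v0 hv].
    have [i Er iN] := Ei _ _ hv.
    have Er' : r = n.+1 - i.+1 by lia.
    have iN' : i < n by have := in_lam_bounds hv; lia.
    have hv' : in_lam a r v by apply: (in_lam_sub hv); have := in_lam_bounds hv; lia.
    have eb := leqW (be _ _ hv).
    rewrite {2}Er' eE -?Er' //; apply: leq_trans (hc _ _ iN' eb).
    by rewrite -eE // -?Er.
  have [i0 Er iN0] := Ei _ _ hv; have hb := in_lam_bounds hv.
  case: i0 Er iN0 => [|i] Er iN; first by lia.
  have hd := in_lam_antidiag v0 hv.
  have Er1 : r.+1 = n.+1 - i by lia.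
  have hv' : in_lam a r v by apply: (in_lam_sub hv); lia.
  rewrite orbC; case: eqVneq => //= ne.
  have lt : e r v.+1 < e r v by rewrite ltn_neqAle ne row.
  have jb := leqW (be _ _ hv').
  have Eh : h i.+1 (e r v) = v.
    apply/eqP; rewrite eqn_leq; apply/andP; split; last by rewrite -eE // -?Er.
    by rewrite leqNgt -eE // -?Er // -ltnNge.
  (* Row i+1 has level v at column e(r,v). If the attachment column j0 is not 0, both rows have
     level v there, so e(r,v+1) < j0 <= e(r+1,v). The case j0 = 0 is impossible, because the mark of
     row i+1 exceeds v. *)
  have [j0 j0m [/nat_inj E H]] := att i (e r v) iN jb.
  rewrite Eh in E H; have va : v < apref a i.+1.
    by move: hv; rewrite Er in_lam_row // => /andP[].
  case: H => [j00|/nat_inj H]; first by move: E; rewrite j00 hA //; lia.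
  apply: (@leq_trans j0).
    by rewrite ltnNge {1}Er eE // -?Er // E ltnn.
  by rewrite Er1 eE -?Er1 // ?H // ltnW.
exists e; split=> // i j iN jm; apply: eq_from_leq => v v0.
rewrite leq_levels //; case: (boolP (in_lam _ _ _)) => hv /=; first exact: eE.
apply/esym/negbTE; rewrite -ltnNge; apply: leq_ltn_trans (hrow i 0 j iN _) _ => //.
by rewrite hA //; move: hv; rewrite in_lam_row // v0 /= -ltnNge.
Qed.

End Levels.

Local Open Scope ring_scope.

(** * Flows on the grid *)

(** At a grid vertex at most one edge of each kind enters or leaves; incidence sums thus have an
    optional term, [None] standing for a missing edge. *)
Lemma big_option (R : nmodType) (T : finType) (P : pred T) (F : T -> R) (o : option T) :
  (forall c, P c = (o == Some c)) -> \sum_(c | P c) F c = oapp F 0 o.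
Proof.
case: o => [c0|] E /=; last by rewrite big_pred0.
by rewrite (big_pred1 c0) // => c; rewrite E /= (inj_eq Some_inj) eq_sym.
Qed.

Definition opair (p q i j : nat) : option ('I_p * 'I_q) :=
  obind (fun i' : 'I_p => omap (pair i') (insub j)) (insub i).

Lemma opair_eq p q i j (c : 'I_p * 'I_q) :
  (opair p q i j == Some c) = (i == c.1 :> nat) && (j == c.2 :> nat).
Proof.
case: c => u v; rewrite /opair; case: (insubP 'I_p i) => [i' _ <-|ip] /=; last first.
  by apply/esym/negbTE/negP => /andP[/eqP E _]; rewrite E ltn_ord in ip.
case: (insubP 'I_q j) => [j' _ <-|jq] /=; first by rewrite (inj_eq Some_inj).
by apply/esym/negbTE/negP => /andP[_ /eqP E]; rewrite E ltn_ord in jq.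
Qed.

Lemma opair_ord p q (c : 'I_p * 'I_q) : opair p q c.1 c.2 = Some c.
Proof. by apply/eqP; rewrite opair_eq !eqxx. Qed.

Lemma ord_pair p q i j : (i < p)%N -> (j < q)%N ->
  exists c : 'I_p * 'I_q, i = c.1 :> nat /\ j = c.2 :> nat.
Proof. by move=> ip jq; exists (Ordinal ip, Ordinal jq). Qed.

Lemma opair_none p q i j : (q <= j)%N -> opair p q i j = None.
Proof.
move=> qj; case E: (opair p q i j) => [c|] //.
by move/eqP: E; rewrite opair_eq => /andP[_ /eqP E]; move: qj; rewrite E leqNgt ltn_ord.
Qed.

Section Edges.
Variables (n m : nat).

(** Below the last row [insub] fails, and [None] is the sink: one formula also covers the edges into
    s. *)
Definition vtarget (c : 'I_n * 'I_m.+1) : gvert n m :=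
  omap (fun i' : 'I_n => (i', c.2)) (insub c.1.+1).

Lemma vtarget_some c i j : (vtarget c == Some (i, j)) = (c.1.+1 == i :> nat) && (c.2 == j).
Proof.
rewrite /vtarget; case: insubP => [i' _ <-|/=] /=; first by rewrite (inj_eq Some_inj).
by move=> H; apply/idP/idP => // /andP[/eqP E _]; rewrite E ltn_ord in H.
Qed.

Lemma vtarget_none c : (vtarget c == None) = (c.1.+1 == n).
Proof.
rewrite /vtarget; case: insubP => [i' lt _|/=] /=; first by rewrite ltn_eqF.
by rewrite -leqNgt eqn_leq ltn_ord => ->.
Qed.

Definition hsource (c : 'I_n * 'I_m) : 'I_n * 'I_m.+1 := (c.1, widen_ord (leqnSn m) c.2).
Definition htarget (c : 'I_n * 'I_m) : 'I_n * 'I_m.+1 := (c.1, lift ord0 c.2).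

Lemma vert_subproof c : is_gedge (Some c, vtarget c).
Proof.
case E: (vtarget c) => [[i' j']|] /=; case: c E => i j /eqP.
  by rewrite vtarget_some /= => /andP[/eqP -> /eqP ->]; rewrite !eqxx orbT.
by rewrite vtarget_none.
Qed.

Lemma hor_subproof c : is_gedge (Some (hsource c) : gvert n m, Some (htarget c) : gvert n m).
Proof. by rewrite /= /bump /= add1n !eqxx. Qed.

Definition vert c : gedge n m := Sub (_, _) (vert_subproof c).
Definition hor c : gedge n m := Sub (_, _) (hor_subproof c).

Definition edge_of (s : ('I_n * 'I_m.+1) + ('I_n * 'I_m)) : gedge n m :=
  match s with inl c => vert c | inr c => hor c end.

Lemma edge_of_inj : injective edge_of.
Proof.
move=> [c|c] [d|d] /(congr1 val) /= [].
- by move=> ->.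
- move=> E1 E2; move/eqP: E2; rewrite vtarget_some /= E1 /=.
  by move=> /andP[/eqP E _]; lia.
- move=> E1 /esym E2; move/eqP: E2; rewrite vtarget_some /= -E1 /=.
  by move=> /andP[/eqP E _]; lia.
- by case: c d => i j [i' j'] /= -> E _; have -> : j = j' by apply: val_inj.
Qed.

Lemma edge_of_surj e : exists s, edge_of s == e.
Proof.
case: e => -[[[i j]|] w] He; last by case: w He.
case: w He => [[i' j']|] He.
  case/orP: (He) => /andP[/eqP Ei /eqP Ej].
    have jm : (j < m)%N by have := ltn_ord j'; lia.
    exists (inr (i, Ordinal jm)); apply/eqP/val_inj => /=; congr (Some _, Some _).
      by congr pair; apply: val_inj.
    by congr pair; apply: val_inj => //=; rewrite /bump /= add1n.
  exists (inl (i, j)); apply/eqP/val_inj => /=; congr pair; apply/eqP.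
  by rewrite vtarget_some /= Ei eqxx; apply/eqP/val_inj.
exists (inl (i, j)); apply/eqP/val_inj => /=; congr pair; apply/eqP.
by rewrite vtarget_none.
Qed.

Lemma edge_of_bij : bijective edge_of.
Proof.
exists (fun e => xchoose (edge_of_surj e)) => [s|e].
  by apply: edge_of_inj; apply/eqP; apply: (xchooseP (edge_of_surj _)).
by apply/eqP; apply: (xchooseP (edge_of_surj _)).
Qed.

Lemma edgeP (P : gedge n m -> Prop) :
  (forall c, P (vert c)) -> (forall c, P (hor c)) -> forall e, P e.
Proof.
by move=> Pv Ph e; have [[c|c] /eqP <-] := edge_of_surj e; [apply: Pv|apply: Ph].
Qed.

Lemma sum_edges (R : nmodType) (P : pred (gedge n m)) (F : gedge n m -> R) :
  \sum_(e | P e) F e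
  = \sum_(c | P (vert c)) F (vert c) + \sum_(c | P (hor c)) F (hor c).
Proof.
have [g gK Kg] := edge_of_bij; rewrite (reindex edge_of); last first.
  by exists g => s _; rewrite ?gK ?Kg.
by rewrite big_sumType.
Qed.

End Edges.

(** * Flows and marked arrays *)

Section Flows.
Variables (R : realFieldType) (n m : nat) (a : n.-tuple bool).
Hypothesis n_gt0 : (0 < n)%N.
Implicit Types (x y z : {ffun gedge n m -> R}) (g : nat -> nat -> R).

Definition xv x (i j : nat) : R := oapp (fun c => x (vert c)) 0 (opair n m.+1 i j).
Definition xh x (i j : nat) : R := oapp (fun c => x (hor c)) 0 (opair n m i j).

Lemma outflow x (i : 'I_n) (j : 'I_m.+1) :
  \sum_(e : gedge n m | (val e).1 == Some (i, j)) x e = xv x i j + xh x i j.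
Proof.
rewrite sum_edges; congr (_ + _); apply: big_option => -[u v] /=.
  by rewrite opair_eq /= (inj_eq Some_inj) xpair_eqE -!val_eqE /= eq_sym [in X in _ && X]eq_sym.
by rewrite opair_eq /= (inj_eq Some_inj) xpair_eqE -!val_eqE /= eq_sym [in X in _ && X]eq_sym.
Qed.

Lemma inflow x (i : 'I_n) (j : 'I_m.+1) :
  \sum_(e : gedge n m | (val e).2 == Some (i, j)) x e
  = (if i : nat is i'.+1 then xv x i' j else 0)
    + (if j : nat is j'.+1 then xh x i j' else 0).
Proof.
rewrite sum_edges; congr (_ + _).
  case Ei: (i : nat) => [|i'].
    by apply: big_pred0 => c /=; rewrite vtarget_some Ei.
  apply: big_option => c /=; rewrite vtarget_some opair_eq Ei eqSS eq_sym.
  by rewrite -val_eqE /= [in X in _ && X]eq_sym.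
case Ej: (j : nat) => [|j'].
  apply: big_pred0 => c /=; rewrite (inj_eq Some_inj) xpair_eqE -[X in _ && X]val_eqE /=.
  by rewrite Ej andbF.
apply: big_option => c /=; rewrite (inj_eq Some_inj) xpair_eqE -!val_eqE /= Ej opair_eq.
by rewrite /bump /= add1n eqSS eq_sym [in X in _ && X]eq_sym.
Qed.

Lemma outflow_sink x : \sum_(e : gedge n m | (val e).1 == None) x e = 0.
Proof. by rewrite sum_edges !big_pred0 ?addr0. Qed.

Lemma inflow_sink x :
  \sum_(e : gedge n m | (val e).2 == None) x e = \sum_(0 <= j < m.+1) xv x n.-1 j.
Proof.
rewrite sum_edges [X in _ + X]big_pred0 ?addr0 //= big_mkord.
transitivity (\sum_(c : 'I_n * 'I_m.+1 | (c.1.+1 == n) && true) x (vert (c.1, c.2))).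
  by apply: eq_big => [c|[i j] _] //; rewrite vtarget_none andbT.
rewrite -(pair_big (fun i : 'I_n => i.+1 == n) xpredT (fun i j => x (vert (i, j)))) /=.
have nP : (n.-1 < n)%N by rewrite prednK.
rewrite (big_pred1 (Ordinal nP)); last first.
  by move=> i /=; rewrite -val_eqE /= -[X in _ == X](prednK n_gt0) eqSS.
apply: eq_bigr => j _; rewrite /xv.
by have := opair_ord (Ordinal nP, j); rewrite /= => ->.
Qed.

Definition array_of x (i j : nat) : R :=
  if i is i'.+1 then \sum_(j <= q < m.+1) xv x i' q else 0.
Arguments array_of : simpl never.

(** What leaves a row downwards in columns beyond j came from above in these columns or crossed the
    horizontal edge at j; this gives the horizontal flow. The test [i' == i] recognises horizontal
    edges. *)
Definition flow_of g : {ffun gedge n m -> R} :=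
  [ffun e : gedge n m => match val e return R with
   | (Some (i, j), Some (i', _)) =>
       if i' == i then g i.+1 j.+1 - g i j.+1 else g i.+1 j - g i.+1 j.+1
   | (Some (i, j), None) => g i.+1 j - g i.+1 j.+1
   | _ => 0
   end].

Lemma flow_vert g c : flow_of g (vert c) = g c.1.+1 c.2 - g c.1.+1 c.2.+1.
Proof.
rewrite ffunE /=; case: c => i j /=; case E: vtarget => [[i' j']|] //.
move/eqP: E; rewrite vtarget_some => /andP[/eqP /= E _].
by case: eqP => // E'; move: E; rewrite E'; lia.
Qed.

Lemma flow_hor g c : flow_of g (hor c) = g c.1.+1 c.2.+1 - g c.1 c.2.+1.
Proof. by rewrite ffunE /= eqxx. Qed.

Lemma xv_flow g i j : (i < n)%N -> (j <= m)%N ->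
  xv (flow_of g) i j = g i.+1 j - g i.+1 j.+1.
Proof.
move=> iN jm; have [c [-> ->]] := @ord_pair n m.+1 i j iN jm.
by rewrite /xv opair_ord /= flow_vert.
Qed.

Lemma xh_flow g i j : (i < n)%N -> (j < m)%N ->
  xh (flow_of g) i j = g i.+1 j.+1 - g i j.+1.
Proof.
move=> iN jm; have [c [-> ->]] := @ord_pair n m i j iN jm.
by rewrite /xh opair_ord /= flow_hor.
Qed.

Lemma xh_end x i : xh x i m = 0.
Proof. by rewrite /xh opair_none. Qed.

Lemma eq_flow g g' : (forall i j, (i <= n)%N -> (j <= m.+1)%N -> g i j = g' i j) ->
  flow_of g = flow_of g'.
Proof.
move=> E; apply/ffunP; apply: edgeP => -[i j].
  by rewrite !flow_vert /= !E // ?ltnS ?(ltnW (ltn_ord j)) // ltnW.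
by rewrite !flow_hor /= !E // ?ltnS ?(ltnW (ltn_ord i)) ?(ltnW (ltn_ord j)).
Qed.

Lemma flow_in_polytope g : marked_array m a g -> in_flow_polytope a (flow_of g).
Proof.
case=> g0 gA gm gr gc; split.
  apply: edgeP => -[i j]; rewrite ?flow_vert ?flow_hor subr_ge0 /=.
    by rewrite gr // -ltnS.
  by rewrite gc // ltnS ltnW.
case=> [[i j]|]; last first.
  rewrite outflow_sink inflow_sink sub0r; congr (- _).
  have -> : \sum_(0 <= j < m.+1) xv (flow_of g) n.-1 j
            = - \sum_(0 <= j < m.+1) (g n j.+1 - g n j).
    rewrite -sumrN; apply: eq_big_nat => j /andP[_ jm].
    by rewrite xv_flow ?prednK // opprB.
  by rewrite telescope_sumr // gm // gA // sub0r opprK.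
rewrite outflow inflow xv_flow //; last by rewrite -ltnS.
(* The formulas persist at the borders: no horizontal edge leaves column m, where column m+1 of g is
   0, and no vertical edge enters the top row, where row 0 of g is 0. *)
have -> : xh (flow_of g) i j = g i.+1 j.+1 - g i j.+1.
  case: (ltnP j m) => jm; first by rewrite xh_flow.
  have -> : (j : nat) = m by have := ltn_ord j; lia.
  by rewrite xh_end !gm ?subrr // ltnW.
have -> : (if i : nat is i'.+1 then xv (flow_of g) i' j else 0) = g i j - g i j.+1.
  have := ltn_ord i; case: (i : nat) => [|i'] lt; first by rewrite !g0 ?subrr // ltnW.
  by rewrite (xv_flow g (ltnW lt)) // -ltnS.
have jm := ltn_ord j; have iN := ltn_ord i.
rewrite /netflow; case: (j : nat) jm => [|j'] jm /=.
  by rewrite (gA _ iN) (gA _ (ltnW iN)) aprefS natrD; ring.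
by rewrite xh_flow //; ring.
Qed.

Lemma array_step x i j : (j <= m)%N ->
  array_of x i.+1 j = xv x i j + array_of x i.+1 j.+1.
Proof. by move=> jm; rewrite /array_of big_ltn. Qed.

Section Point.
Variable x : {ffun gedge n m -> R}.
Hypothesis xP : in_flow_polytope a x.

Lemma xv_ge0 i j : 0 <= xv x i j.
Proof. by case: xP => x0 _; rewrite /xv; case: opair => //= c. Qed.

Lemma xh_ge0 i j : 0 <= xh x i j.
Proof. by case: xP => x0 _; rewrite /xh; case: opair => //= c. Qed.

Lemma balance i j : (i < n)%N -> (j <= m)%N ->
  xv x i j + xh x i j - ((if i is i'.+1 then xv x i' j else 0)
    + (if j is j'.+1 then xh x i j' else 0))
  = if j == 0%N then (acoef a i.+1)%:R else 0.
Proof.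
move=> iN jm; case: xP => _ /(_ (Some (Ordinal iN, Ordinal (jm : (j < m.+1)%N)))).
by rewrite outflow inflow.
Qed.

Lemma array_end i : array_of x i m.+1 = 0.
Proof. by case: i => // i; rewrite /array_of big_geq. Qed.

(** Conservation determines the horizontal flows from right to left, starting at column m, which no
    horizontal edge leaves; d is the distance to that column. *)
Lemma xh_array i d : (i < n)%N -> (d <= m)%N ->
  xh x i (m - d) = array_of x i.+1 (m - d).+1 - array_of x i (m - d).+1.
Proof.
move=> iN; elim: d => [|d IH] dm; first by rewrite subn0 xh_end !array_end subrr.
have {}IH := IH (ltnW dm).
have E : (m - d)%N = (m - d.+1).+1 by lia.
have dm' : ((m - d.+1).+1 <= m)%N by lia.
have := balance iN dm'; rewrite /= -E IH (@array_step x i (m - d)); last by lia.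
case: i iN IH => [|i] iN IH; first by rewrite /array_of /=; lra.
by rewrite [X in _ -> _ = _ - X](@array_step x i (m - d)); [lra|lia].
Qed.

(** Nonnegative vertical flows give the inequalities along rows, and nonnegative horizontal flows
    those between rows. In column 0 the latter come from the prefix sums, which conservation at
    column 0 produces. *)
Lemma array_marked : marked_array m a (array_of x).
Proof.
have gA i : (i <= n)%N -> array_of x i 0 = (apref a i)%:R.
  elim: i => [|i IH] iN; first by rewrite apref0.
  rewrite aprefS natrD -IH; last exact: ltnW.
  have := balance iN (leq0n m); rewrite /= addr0 => <-.
  have := xh_array iN (leqnn m); rewrite subnn => ->; rewrite array_step //.
  case: i iN IH => [|i] iN IH; first by rewrite /array_of; lra.
  by rewrite (@array_step x i 0) //; lra.
split=> //.
- by move=> i _; apply: array_end.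
- by move=> [|i] j iN jm //; rewrite (@array_step x i j) // lerDr xv_ge0.
move=> i [|j] iN jm; first by rewrite (gA _ iN) (gA _ (ltnW iN)) ler_nat leq_apref.
by have := @xh_array i (m - j) iN (leq_subr _ _); rewrite subKn // -subr_ge0 => <-; apply: xh_ge0.
Qed.

Lemma flow_of_array : flow_of (array_of x) = x.
Proof.
apply/ffunP; apply: edgeP => c.
  rewrite flow_vert array_step; last by have := ltn_ord c.2.
  by rewrite addrK /xv opair_ord.
have jm := ltn_ord c.2.
have := @xh_array c.1 (m - c.2) (ltn_ord _) (leq_subr _ _).
by rewrite subKn ?(ltnW jm) // flow_hor => <-; rewrite /xh opair_ord.
Qed.

End Point.

Lemma array_of_flow g i j : marked_array m a g -> (i <= n)%N -> (j <= m.+1)%N ->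
  array_of (flow_of g) i j = g i j.
Proof.
case=> g0 _ gm _ _; case: i => [|i] iN jm; first by rewrite g0.
rewrite /array_of (_ : \sum_(j <= q < m.+1) _ = - \sum_(j <= q < m.+1) (g i.+1 q.+1 - g i.+1 q)).
  by rewrite telescope_sumr // gm // sub0r opprK.
rewrite -sumrN; apply: eq_big_nat => q /andP[_ qm].
by rewrite xv_flow // opprB.
Qed.

Lemma array_of_convex x y z t i j : (forall e, x e = t * y e + (1 - t) * z e) ->
  array_of x i j = t * array_of y i j + (1 - t) * array_of z i j.
Proof.
move=> E; case: i => [|i]; rewrite /array_of; first by rewrite !mulr0 addr0.
rewrite !mulr_sumr -big_split; apply: eq_bigr => q _ /=.
by rewrite /xv; case: opair => /= [c|]; rewrite ?E // !mulr0 addr0.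
Qed.

(** An attached array is rigid, which fixes both ends of any segment through it. Conversely, a
    detached level set can be shifted by e and by -e, which makes x the midpoint of two distinct
    points. *)
Lemma poly_vertexP x :
  is_poly_vertex a x <-> in_flow_polytope a x /\ attached n m (array_of x).
Proof.
split=> [[xP ext]|[xP att]]; split=> //; last first.
  move=> y z t yP zP t01 E.
  have Ey := attached_rigid att (array_marked xP) (array_marked yP)
    (array_marked zP) t01 (fun i j _ _ => array_of_convex i j E).
  have t01' : 0 < 1 - t < 1 by lra.
  have E' e : x e = (1 - t) * z e + (1 - (1 - t)) * y e by rewrite E; ring.
  have Ez := attached_rigid att (array_marked xP) (array_marked zP)
    (array_marked yP) t01' (fun i j _ _ => array_of_convex i j E').
  rewrite -(flow_of_array yP) -(flow_of_array zP); apply: eq_flow => i j iN jm.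
  by rewrite Ey ?Ez.
set g := array_of x; have gok : marked_array m a g := array_marked xP.
move=> i j iN jm.
case: (boolP [exists j0 : 'I_m.+2, (g i.+1 j0 == g i.+1 j) &&
    ((j0 == 0 :> nat) || (g i j0 == g i.+1 j))]) => [/existsP[j0]|no].
  case/andP=> /eqP E1 /orP H; exists j0; first by have := ltn_ord j0.
  by split=> //; case: H => /eqP; [left|right].
have [e e0 pert] : exists2 eps : R, 0 < eps & forall s : R, `|s| = eps ->
    marked_array m a (fun p q => g p q + s *+ ((i < p)%N && (g p q == g i.+1 j))).
  apply: detached_perturb => // j0 j0m E.
  move/existsPn/(_ (Ordinal (j0m : (j0 < m.+2)%N))): no.
  by rewrite /= E eqxx /= negb_or => /andP[/eqP ? /eqP ?].
have ok1 := pert e (gtr0_norm e0).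
have ok2 := pert (- e) ltac:(by rewrite normrN gtr0_norm).
set g1 := (fun p q => _) in ok1; set g2 := (fun p q => _) in ok2.
have : flow_of g1 = flow_of g2.
  apply: (ext _ _ 2^-1); [exact: flow_in_polytope|exact: flow_in_polytope|lra|].
  move=> u; rewrite -[in LHS](flow_of_array xP) -/g; move: u.
  by apply: edgeP => c; rewrite ?flow_vert ?flow_hor /g1 /g2 !mulNrn; lra.
move/(congr1 (fun y => array_of y i.+1 j)).
rewrite (array_of_flow ok1 iN jm) (array_of_flow ok2 iN jm) /g1 /g2 ltnSn eqxx /= !mulr1n.
by lra.
Qed.

(** * Vertices as vertex plane partitions *)

Definition vflow (f : {ffun 'I_n * 'I_n -> option 'I_m.+1}) : {ffun gedge n m -> R} :=
  flow_of (fun i j => (levels a (ent f) i j)%:R).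

Lemma vfill_bounded (f : {ffun 'I_n * 'I_n -> option 'I_m.+1}) : bounded m a (ent f).
Proof. by move=> i j _; rewrite -ltnS ent_lt. Qed.

Lemma vflow_inj : {in [set f | vfill a f] &, injective vflow}.
Proof.
move=> f f'; rewrite !inE => fv fv' E; apply: (levels_inj fv fv') => i j iN jm.
case/vfillP: (fv) => _ G; case/vfillP: (fv') => _ G'.
have ok := levels_marked R G (vfill_bounded f).
have ok' := levels_marked R G' (vfill_bounded f').
move/(congr1 (fun y => array_of y i j)): E.
rewrite (array_of_flow ok iN jm) (array_of_flow ok' iN jm).
by move/eqP; rewrite eqr_nat => /eqP.
Qed.

(** The array of a vertex is attached, hence has natural values, and [levels_surj] turns it into a
    plane partition. The converse is [levels_attached]. *)
Lemma vflow_vertex x : is_poly_vertex a x <->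
  exists2 f, vfill a f & x = vflow f.
Proof.
split=> [/poly_vertexP[xP att]|[f /vfillP[_ G] ->]].
  have ok := array_marked xP; have nat_g := attached_nat ok att.
  have ex i j : exists k : nat,
      (i <= n)%N && (j <= m.+1)%N ==> (array_of x i j == k%:R).
    case: (boolP (_ && _)) => [/andP[iN jm]|_]; last by exists 0%N.
    by have [k ->] := nat_g i j iN jm; exists k; rewrite eqxx.
  pose h i j := xchoose (ex i j).
  have hE i j : (i <= n)%N -> (j <= m.+1)%N -> array_of x i j = (h i j)%:R.
    by move=> iN jm; have /implyP/(_ ltac:(by rewrite iN jm))/eqP := xchooseP (ex i j).
  have okh : marked_array m a (fun i j => (h i j)%:R : R).
    case: ok => g0 gA gm gr gc; split.
    + by move=> j jm; rewrite -hE // g0.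
    + by move=> i iN; rewrite -hE // gA.
    + by move=> i iN; rewrite -hE // gm.
    + by move=> i j iN jm; rewrite -!hE // ?gr // leqW.
    + by move=> i j iN jm; rewrite -!hE // ?gc // ltnW.
  have atth : attached n m (fun i j => (h i j)%:R : R).
    move=> i j iN jm; have [j0 j0m H] := att i j iN jm; exists j0 => //.
    by rewrite -!hE // ltnW.
  have [e [ge be Ee]] := levels_surj okh atth.
  have [f fv Ef] := exists_fill ge be; exists f => //.
  rewrite -(flow_of_array xP); apply: eq_flow => i j iN jm.
  by rewrite hE // -Ee // (eq_levels Ef).
have ok := levels_marked R G (vfill_bounded f).
apply/poly_vertexP; split; first exact: flow_in_polytope.
move=> i j iN jm; have [j0 j0m H] := levels_attached R G (vfill_bounded f) iN jm.
by exists j0 => //; rewrite !(array_of_flow ok) // ltnW.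
Qed.

Lemma num_vertices_vfill :
  num_vertices_is R m a #|[set f : {ffun 'I_n * 'I_n -> option 'I_m.+1} | vfill a f]|.
Proof.
exists [seq vflow f | f <- enum [set f | vfill a f]]; split.
- rewrite map_inj_in_uniq ?enum_uniq // => f f'; rewrite !mem_enum.
  exact: vflow_inj.
- by rewrite size_map -cardE.
move=> x; split=> [/vflow_vertex[f fv ->]|/mapP[f]].
  by apply: map_f; rewrite mem_enum inE.
by rewrite mem_enum inE => fv ->; apply/vflow_vertex; exists f.
Qed.

End Flows.

Theorem theorem5p40 (R : realFieldType) (n : nat) (a : n.-tuple bool) :
  (0 < n)%N ->
  exists P : {poly rat},
    [/\ exists m0 : nat, forall m : nat, (m0 <= m)%N ->
          exists k : nat, num_vertices_is R m a k /\ P.[m%:R] = k%:R,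
        size P = (lsize a).+1,
        ((lsize a)`!)%:R * P`_(lsize a) = (p_a0 a (lsize a))%:R
      & p_a0 a (lsize a) = syt_count a].
Proof.
move=> n_gt0; have [P [PE sP cP]] := binomial_sum_poly (p_a0_gt0 a).
exists P; split=> //; last exact: p_a0_syt.
(* Entries at most m form m+1 values, matching the m+1 in the binomial sum, so the polynomial agrees
   from m = 0 on. *)
exists 0%N => m _; eexists; split; first exact: num_vertices_vfill.
by rewrite PE card_vfill.
Qed.
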